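(* If $(M,g,w)$ is a compact $(\lambda,n+m)$-Einstein manifold with $\lambda\le 0$, then it is trivial, i.e. $w$ is constant.
   Context: Let $n\ge1$ be an integer, $m\ge 1$ a real number and $\lambda\in\mathbb{R}$. A $(\lambda,n+m)$-Einstein manifold $(M^n,g,w)$ is a connected complete Riemannian $n$-manifold $(M,g)$, possibly with boundary, together with a smooth function $w$ on $M$ such that $\mathrm{Hess}\,w=\frac{w}{m}(\mathrm{Ric}-\lambda g)$ on $M$, $w>0$ on $\mathrm{int}(M)$, and $w=0$ on $\partial M$. When $m=1$ one additionally assumes $\Delta w=-\lambda w$. It is called trivial if $w$ is constant (in which case $\mathrm{Ric}=\lambda g$ and $\partial M=\emptyset$). Here ''compact'' allows non-empty boundary. *)

(* Defs.v *)
From HB Require Import structures.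
From mathcomp Require Import all_boot all_order all_algebra.
From mathcomp Require Import all_classical all_reals all_analysis.
Import Order.TTheory GRing.Theory Num.Theory.
Import numFieldTopology.Exports numFieldNormedType.Exports.

Set Implicit Arguments.
Unset Strict Implicit.
Unset Printing Implicit Defensive.

Local Open Scope classical_set_scope.
Local Open Scope ring_scope.

Section Euclidean.
Variables (R : realType) (n : nat).
Implicit Types (f F : 'rV[R]_n -> R) (U V : set 'rV[R]_n) (x : 'rV[R]_n).

Definition basis_vec (i : 'I_n) : 'rV[R]_n := delta_mx ord0 i.

(* The first coordinate is the one normal to the boundary. *)
Definition half_space : set 'rV[R]_n :=
  [set x | forall i : 'I_n, i = 0%N :> nat -> 0 <= x ord0 i].

Definition half_space_boundary : set 'rV[R]_n :=
  [set x | forall i : 'I_n, i = 0%N :> nat -> x ord0 i = 0].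

(* C^infty on an open set: iterated partial derivatives of every order and in
   every order of differentiation exist and are continuous. *)
Definition iter_partial (s : seq 'I_n) F : 'rV[R]_n -> R :=
  foldr (fun i h => 'D_(basis_vec i) h) F s.

Definition smooth_open V F : Prop :=
  forall (s : seq 'I_n) x, V x ->
    {for x, continuous (iter_partial s F)} /\
    forall i, derivable (iter_partial s F) x (basis_vec i).

(* Smoothness on an arbitrary subset: local smooth extendability to open
   subsets of R^n. *)
Definition smooth_on U f : Prop :=
  forall x, U x -> exists V F,
    [/\ open V, V x, smooth_open V F & forall y, V y -> U y -> F y = f y].

(* i-th partial derivative relative to the half-space: two-sided at points off
   the boundary, one-sided in the normal direction at boundary points. *)
Definition partial (i : 'I_n) f x : R :=
  lim ((fun h : R => h^-1 * (f (h *: basis_vec i + x) - f x))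
    @ within [set h | half_space (h *: basis_vec i + x)] 0^').

(* Tensor calculus in coordinates; G x is the matrix (g_ij) at x. *)
Implicit Type G : 'rV[R]_n -> 'M[R]_n.

Definition christoffel G (k i j : 'I_n) x : R :=
  2^-1 * \sum_(l < n) invmx (G x) k l *
    (partial i (fun y => G y j l) x + partial j (fun y => G y i l) x
     - partial l (fun y => G y i j) x).

(* R(d_i, d_j) d_k = \sum_l (riemann G l k i j) d_l *)
Definition riemann G (l k i j : 'I_n) x : R :=
  partial i (christoffel G l j k) x - partial j (christoffel G l i k) x
  + \sum_(p < n) (christoffel G l i p x * christoffel G p j k x
                  - christoffel G l j p x * christoffel G p i k x).

Definition ricci G x : 'M[R]_n :=
  \matrix_(j, k) \sum_(i < n) riemann G i k i j x.

Definition hessian G f x : 'M[R]_n :=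
  \matrix_(i, j) (partial i (partial j f) x
                  - \sum_(k < n) christoffel G k i j x * partial k f x).

Definition laplacian G f x : R := \tr (invmx (G x) *m hessian G f x).

End Euclidean.

Section Manifold.
Variables (R : realType) (n : nat) (M : topologicalType).

(* cmap is meaningful on cdom only, and cinv on the image cimg only. *)
Record chart := Chart {
  cdom : set M;
  cmap : M -> 'rV[R]_n;
  cinv : 'rV[R]_n -> M }.

Implicit Types (c : chart) (A : set chart) (p q : M).

Definition cimg c : set 'rV[R]_n := cmap c @` cdom c.

(* A homeomorphism from an open subset of M onto a relatively open subset of
   the closed half-space; interior charts are those missing its boundary. *)
Record is_chart c : Prop := IsChart {
  cdom_open : open (cdom c);
  cimg_open : exists2 V, open V & cimg c = V `&` @half_space R n;
  cmapK : {in cdom c, cancel (cmap c) (cinv c)};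
  cmap_continuous : {within cdom c, continuous (cmap c)};
  cinv_continuous : {within cimg c, continuous (cinv c)} }.

Definition transition c c' (i : 'I_n) : 'rV[R]_n -> R :=
  fun x => cmap c' (cinv c x) ord0 i.

Record smooth_atlas A : Prop := SmoothAtlas {
  atlas_chart : forall c, A c -> is_chart c;
  atlas_cover : forall p, exists2 c, A c & cdom c p;
  atlas_smooth : forall c c', A c -> A c' -> forall i,
    smooth_on (cmap c @` (cdom c `&` cdom c')) (transition c c' i) }.

Record smooth_manifold A : Prop := SmoothManifold {
  manifold_hausdorff : hausdorff_space M;
  manifold_second_countable : @second_countable M;
  manifold_atlas : smooth_atlas A }.

Definition boundary A : set M :=
  [set p | exists c, [/\ A c, cdom c p & half_space_boundary (cmap c p)]].

Definition smooth_function A (w : M -> R) : Prop :=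
  forall c, A c -> smooth_on (cimg c) (w \o cinv c).

Definition jacobian c c' (x : 'rV[R]_n) : 'M[R]_n :=
  \matrix_(k, i) partial i (transition c c' k) x.

(* A metric is given by its component matrices g c in each chart c of the
   atlas, related by the transformation law of covariant 2-tensors. *)
Record riemannian_metric A (g : chart -> 'rV[R]_n -> 'M[R]_n) : Prop :=
  RiemannianMetric {
  metric_smooth : forall c, A c -> forall i j,
    smooth_on (cimg c) (fun x => g c x i j);
  metric_sym : forall c, A c -> forall x, cimg c x -> (g c x)^T = g c x;
  metric_posdef : forall c, A c -> forall x, cimg c x ->
    forall v : 'rV[R]_n, v != 0 -> 0 < (v *m g c x *m v^T) ord0 ord0;
  metric_tensor : forall c c', A c -> A c' ->
    forall p, cdom c p -> cdom c' p ->
    let J := jacobian c c' (cmap c p) in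
    g c (cmap c p) = J^T *m g c' (cmap c' p) *m J }.

Implicit Type g : chart -> 'rV[R]_n -> 'M[R]_n.

(* C^1 curves R -> M.  They need not be regular, so corners of a piecewise C^1
   curve can be removed by stopping there, and the infimum defining the
   distance is the same as for piecewise C^1 segments. *)
Definition velocity c (u : R -> M) (t : R) : 'rV[R]_n :=
  \row_i derive1 (fun s => cmap c (u s) ord0 i) t.

Definition C1_curve A (u : R -> M) : Prop :=
  continuous u /\
  forall t c (i : 'I_n), A c -> cdom c (u t) ->
    derivable (fun s => cmap c (u s) ord0 i) t 1 /\
    {for t, continuous (fun s => velocity c u s ord0 i)}.

Definition is_speed A g (u : R -> M) (v : R -> R) : Prop :=
  forall t c, A c -> cdom c (u t) ->
    v t = Num.sqrt ((velocity c u t *m g c (cmap c (u t))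
                     *m (velocity c u t)^T) ord0 ord0).

Definition curve_lengths A g p q : set R :=
  [set L | exists u v, [/\ C1_curve A u, u 0 = p, u 1 = q, is_speed A g u v
    & L = (\int[lebesgue_measure]_(t in `[0, 1]) v t)%R]].

Definition riemannian_distance A g p q : R := inf (curve_lengths A g p q).

Definition complete_metric A g : Prop :=
  forall u : nat -> M,
    (forall e : R, 0 < e -> exists N, forall i j, (N <= i)%N -> (N <= j)%N ->
      riemannian_distance A g (u i) (u j) < e) ->
    exists p, u @ \oo --> p.

Record einstein_manifold (lambda m : R) A g (w : M -> R) : Prop :=
  EinsteinManifold {
  einstein_smooth_manifold : smooth_manifold A;
  einstein_connected : connected [set: M];
  einstein_metric : riemannian_metric A g;
  einstein_complete : complete_metric A g;
  einstein_smooth : smooth_function A w;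
  einstein_eq : forall c, A c -> forall x, cimg c x ->
    hessian (g c) (w \o cinv c) x
    = (w (cinv c x) / m) *: (ricci (g c) x - lambda *: g c x);
  einstein_interior : forall p, ~ boundary A p -> 0 < w p;
  einstein_boundary : forall p, boundary A p -> w p = 0;
  einstein_m1 : m = 1 -> forall c, A c -> forall x, cimg c x ->
    laplacian (g c) (w \o cinv c) x = - lambda * w (cinv c x) }.

Definition trivial_einstein (w : M -> R) : Prop := exists a, forall p, w p = a.

End Manifold.

(* Main.v *)
Require Import Defs.
From HB Require Import structures.
From mathcomp Require Import all_boot all_order all_algebra.
From mathcomp Require Import all_classical all_reals all_analysis.
From mathcomp Require Import ring lra.
Import Order.TTheory GRing.Theory Num.Theory.
Import numFieldTopology.Exports numFieldNormedType.Exports.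
Set Implicit Arguments.
Unset Strict Implicit.
Unset Printing Implicit Defensive.
Local Open Scope classical_set_scope.
Local Open Scope ring_scope.

(** The function [Q = w * Lap w + (m - 1) |grad w|^2 + lambda w^2] is constant on
    [M]: contracting the commutator of two covariant derivatives of [grad w] and
    using [div Ric = d scal / 2] gives [dQ = 0].  Let [k] be its value.  At a
    maximum of [w], an interior point, [k <= lambda (max w)^2]; at a minimum,
    [k >= lambda (min w)^2], trivially so if [w = 0] there.  If [lambda < 0] this
    forces [max w = min w].  If [lambda = 0] then [k = 0], so [w] solves
    [w Lap w + (m - 1) |grad w|^2 = 0], and by the strong maximum principle the
    set where [w] is maximal is open and closed.  This covers [m = 1] as well.

    The tensor identities are proved in a commutative ring with commuting
    derivations, then applied to the ring of functions smooth up to the boundary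
    on the image of a chart.  That [Q] does not depend on the chart follows from
    [2 Hess f (grad a, grad b) = <grad a, grad <grad f, grad b>>
      + <grad b, grad <grad f, grad a>> - <grad f, grad <grad a, grad b>>],
    which reduces it to first derivatives. *)

(** * Tensor calculus in a differential ring *)

(** The shape of Q comes from warped products: for an integer m >= 2, a metric g + w^2 g_F with an
    m-dimensional fibre F is Einstein with constant lambda only if Ric_F = Q g_F. The identity dQ =
    0 is wanted up to the boundary, since the minimum of w may lie there, where Q = (m - 1) |grad
    w|^2. Derivatives are then one-sided in the normal direction, and tensors built from [partial]
    are uncontrolled off the image of the chart. Abstract derivations isolate what the tensor
    identities use: additivity, the Leibniz rule and the symmetry of second derivatives. Where w >
    0, the equation for lambda = 0 says that w^m is harmonic. As m is real, Hopf's comparison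
    argument is run on w itself: the extra gradient term is quadratic in the size of the barrier,
    the gain from the barrier is linear, so a small barrier suffices. *)

Section DifferentialRing.
Variables (A : comPzRingType) (n : nat) (D : 'I_n -> A -> A).
Hypothesis derD : forall i a b, D i (a + b) = D i a + D i b.
Hypothesis derM : forall i a b, D i (a * b) = D i a * b + a * D i b.
Hypothesis derC : forall i j a, D i (D j a) = D j (D i a).

Lemma der0 i : D i 0 = 0.
Proof. by apply: (addrI (D i 0)); rewrite -derD !addr0. Qed.

Lemma der1 i : D i 1 = 0.
Proof. by apply: (addrI (D i 1)); rewrite -{3}[1]mul1r derM mulr1 mul1r addr0. Qed.

Lemma derN i a : D i (- a) = - D i a.
Proof. by apply: (addrI (D i a)); rewrite -derD !subrr der0. Qed.

Lemma derB i a b : D i (a - b) = D i a - D i b.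
Proof. by rewrite derD derN. Qed.

Lemma der_sum i (I : Type) (r : seq I) (p : pred I) (F : I -> A) :
  D i (\sum_(k <- r | p k) F k) = \sum_(k <- r | p k) D i (F k).
Proof. exact: (big_morph (D i) (derD i) (der0 i)). Qed.

Definition dermx i p q (B : 'M[A]_(p, q)) : 'M[A]_(p, q) := map_mx (D i) B.

Lemma dermxE i p q (B : 'M[A]_(p, q)) k l : dermx i B k l = D i (B k l).
Proof. by rewrite mxE. Qed.

Lemma dermxD i p q (B C : 'M[A]_(p, q)) :
  dermx i (B + C) = dermx i B + dermx i C.
Proof. by apply/matrixP => k l; rewrite !mxE derD. Qed.

Lemma dermxN i p q (B : 'M[A]_(p, q)) : dermx i (- B) = - dermx i B.
Proof. by apply/matrixP => k l; rewrite !mxE derN. Qed.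

Lemma dermxM i p q r (B : 'M[A]_(p, q)) (C : 'M[A]_(q, r)) :
  dermx i (B *m C) = dermx i B *m C + B *m dermx i C.
Proof.
apply/matrixP => k l; rewrite !mxE der_sum -big_split /=.
by apply: eq_bigr => s _; rewrite !mxE derM.
Qed.

Lemma dermxC i j p q (B : 'M[A]_(p, q)) :
  dermx i (dermx j B) = dermx j (dermx i B).
Proof. by apply/matrixP => k l; rewrite !mxE derC. Qed.

Lemma dermx_tr i p q (B : 'M[A]_(p, q)) : dermx i B^T = (dermx i B)^T.
Proof. by rewrite /dermx map_trmx. Qed.

Lemma dermx1 i p : dermx i (1%:M : 'M[A]_p) = 0.
Proof.
apply/matrixP => k l; rewrite !mxE.
by case: (k == l); rewrite (der1, der0).
Qed.

Let addmxE p q (B C : 'M[A]_(p, q)) i j : (B + C) i j = B i j + C i j.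
Proof. by rewrite mxE. Qed.

Let oppmxE p q (B : 'M[A]_(p, q)) i j : (- B) i j = - B i j.
Proof. by rewrite mxE. Qed.

Let addmx_tr p q (B C : 'M[A]_(p, q)) : (B + C)^T = B^T + C^T.
Proof. exact: linearD. Qed.

Let oppmx_tr p q (B : 'M[A]_(p, q)) : (- B)^T = - B^T.
Proof. exact: linearN. Qed.

(** * Metric, inverse metric and Christoffel symbols *)

Variables (half : A) (G P : 'M[A]_n).
Hypothesis halfD : half + half = 1.
Hypothesis GT : G^T = G.
Hypothesis PG : P *m G = 1%:M.
Hypothesis GP : G *m P = 1%:M.

Let Gsym i j : G i j = G j i.
Proof. by rewrite -{1}GT mxE. Qed.

Let half2 a : half * (a + a) = a.
Proof. by rewrite mulrDr -mulrDl halfD mul1r. Qed.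

Lemma invmetric_sym : P^T = P.
Proof.
have H : P^T *m G = 1%:M by rewrite -{1}GT -trmx_mul GP trmx1.
by rewrite -[LHS]mulmx1 -GP mulmxA H mul1mx.
Qed.

Let Psym i j : P i j = P j i.
Proof. by rewrite -{1}invmetric_sym mxE. Qed.

Definition chr k i j : A :=
  half * \sum_(l < n) P k l * (D i (G j l) + D j (G i l) - D l (G i j)).

Lemma chr_sym k i j : chr k i j = chr k j i.
Proof.
rewrite /chr; congr (_ * _); apply: eq_bigr => l _.
by rewrite (Gsym i j) (addrC (D i _)).
Qed.

Definition chrmx i : 'M[A]_n := \matrix_(k, j) chr k i j.

Lemma chrmxE i k j : chrmx i k j = chr k i j.
Proof. by rewrite mxE. Qed.

Lemma chrmx_trE i k j : (chrmx i)^T k j = chr j i k.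
Proof. by rewrite !mxE. Qed.

Lemma metric_chrmx i : G *m chrmx i =
  \matrix_(l, j) (half * (D i (G j l) + D j (G i l) - D l (G i j))).
Proof.
pose C : 'M[A]_n := \matrix_(l, j) (half * (D i (G j l) + D j (G i l) - D l (G i j))).
rewrite -/C -[RHS]mul1mx -GP -mulmxA; congr (_ *m _).
apply/matrixP => k j; rewrite !mxE /chr mulr_sumr; apply: eq_bigr => l _.
by rewrite !mxE mulrCA.
Qed.

(** The metric is parallel. By [metric_chrmx], the right side adds a lowered Christoffel symbol to
    its transpose; all but the derivative of G along i cancels. *)
Lemma chr_metric i : dermx i G = (chrmx i)^T *m G + G *m chrmx i.
Proof.
have -> : (chrmx i)^T *m G = (G *m chrmx i)^T by rewrite trmx_mul GT.
rewrite metric_chrmx; apply/matrixP => k j; rewrite !mxE.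
rewrite (Gsym k j) -mulrDr -[LHS]half2; congr (_ * _); ring.
Qed.

Lemma chr_invmetric i : dermx i P = - (chrmx i *m P + P *m (chrmx i)^T).
Proof.
have H : dermx i P *m G + P *m dermx i G = 0 by rewrite -dermxM PG dermx1.
rewrite -[LHS]mulmx1 -GP mulmxA.
rewrite -[dermx i P *m G](addrK (P *m dermx i G)) H sub0r chr_metric.
by rewrite mulmxDr !mulmxA PG mul1mx mulNmx mulmxDl -!mulmxA GP mulmx1 addrC.
Qed.

(** * Curvature, the second Bianchi identity and its contraction *)

Definition riem l k i j : A :=
  D i (chr l j k) - D j (chr l i k)
  + \sum_(p < n) (chr l i p * chr p j k - chr l j p * chr p i k).

(** The commutator of the covariant derivatives [D i] + [chrmx i] and [D j] + [chrmx j] on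
    columns. *)
Definition riemmx i j : 'M[A]_n :=
  dermx i (chrmx j) - dermx j (chrmx i)
  + (chrmx i *m chrmx j - chrmx j *m chrmx i).

Lemma riemmxE i j l k : riemmx i j l k = riem l k i j.
Proof.
rewrite !mxE /riem sumrB; congr (_ + (_ - _));
by apply: eq_bigr => p _; rewrite !mxE.
Qed.

Lemma riemmx_skew i j : riemmx j i = - riemmx i j.
Proof. by rewrite /riemmx opprD !opprB. Qed.

(** The Jacobi identity for three operators [D i] + [chrmx i]. The Christoffel terms that belong to
    the indices i, j, k themselves cancel in the cyclic sum and are left out. *)
Lemma bianchi k i j :
  (dermx k (riemmx i j) + chrmx k *m riemmx i j - riemmx i j *m chrmx k)
  + (dermx i (riemmx j k) + chrmx i *m riemmx j k - riemmx j k *m chrmx i)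
  + (dermx j (riemmx k i) + chrmx j *m riemmx k i - riemmx k i *m chrmx j) = 0.
Proof.
rewrite /riemmx !(dermxD, dermxN, dermxM, mulmxDl, mulmxDr, mulmxBl, mulmxBr).
rewrite !(mulmxN, mulNmx, mulmxDl, mulmxDr, mulmxBl, mulmxBr) !mulmxA.
rewrite !(mulmxN, mulNmx, opprD, opprB, opprK).
rewrite (dermxC j i) (dermxC k i) (dermxC k j).
apply/matrixP => s t; rewrite !(addmxE, oppmxE) ?[RHS]mxE; ring.
Qed.

Definition riemup i j : 'M[A]_n := riemmx i j *m P.

Lemma riemup_skew i j : riemup j i = - riemup i j.
Proof. by rewrite /riemup riemmx_skew mulNmx. Qed.

(** The commutator of two covariant derivatives kills the parallel tensor P: this is what commuting
    second derivatives of P, rewritten by [chr_invmetric], amounts to. *)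
Lemma riemup_tr i j : (riemup i j)^T = - riemup i j.
Proof.
have ric : riemmx i j *m P + P *m (riemmx i j)^T = 0.
  have := dermxC i j P; rewrite !chr_invmetric !(dermxN, dermxD, dermxM, dermx_tr).
  rewrite !chr_invmetric => /eqP; rewrite -subr_eq0 => /eqP H.
  rewrite -[RHS]oppr0 -[in RHS]H /riemmx.
  rewrite !(addmx_tr, oppmx_tr) !trmx_mul.
  rewrite !(mulmxN, mulNmx, mulmxDl, mulmxDr, mulmxBl, mulmxBr).
  rewrite !(mulmxN, mulNmx, opprD, opprB, opprK) !mulmxA.
  apply/matrixP => s t; rewrite !(addmxE, oppmxE) ?[RHS]mxE; ring.
rewrite /riemup trmx_mul invmetric_sym.
by apply/eqP; rewrite -addr_eq0 addrC ric.
Qed.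

Lemma riemup_skewT i j p q : riemup i j p q = - riemup i j q p.
Proof. by have /matrixP/(_ q p) := riemup_tr i j; rewrite !mxE. Qed.

Lemma bianchi_up k i j :
  (dermx k (riemup i j) + chrmx k *m riemup i j + riemup i j *m (chrmx k)^T)
  + (dermx i (riemup j k) + chrmx i *m riemup j k + riemup j k *m (chrmx i)^T)
  + (dermx j (riemup k i) + chrmx j *m riemup k i + riemup k i *m (chrmx j)^T) = 0.
Proof.
rewrite /riemup !dermxM !chr_invmetric.
rewrite -[RHS](mul0mx _ P) -(bianchi k i j).
move: (riemmx i j) (riemmx j k) (riemmx k i) => X Y Z.
rewrite !(mulmxN, mulNmx, mulmxDl, mulmxDr, mulmxBl, mulmxBr, opprD) !mulmxA.
apply/matrixP => s t; rewrite !(addmxE, oppmxE) ?[RHS]mxE; ring.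
Qed.

Definition ricmx : 'M[A]_n := \matrix_(j, k) \sum_(i < n) riem i k i j.

(** The Ricci tensor with one index raised, transposed so that contracting its first index with df
    gives [ricmx *m grad f]. *)
Definition ricup : 'M[A]_n := P *m ricmx^T.

Lemma ricupE i j : ricup i j = \sum_(p < n) riemup p j p i.
Proof.
rewrite mxE; under eq_bigr do rewrite !mxE mulr_sumr.
rewrite exchange_big; apply: eq_bigr => p _; rewrite mxE.
by apply: eq_bigr => k _; rewrite riemmxE mulrC Psym.
Qed.

Let skew_sym_sum (F H : 'I_n -> 'I_n -> A) :
  (forall i j, F i j = - F j i) -> (forall i j, H i j = H j i) ->
  \sum_i \sum_j F i j * H i j = 0.
Proof.
move=> Fskew Hsym; rewrite -[LHS]half2 mulrDr.
rewrite {2}exchange_big /= -mulrDr -big_split big1 ?mulr0 // => i _.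
rewrite -big_split big1 // => j _.
by rewrite /= (Fskew i j) (Hsym i j) mulNr addNr.
Qed.

(** The covariant divergence of a mixed tensor whose first index is the upper one. *)
Definition divergence (E : 'M[A]_n) j : A :=
  \sum_i D i (E i j) + \sum_i \sum_p chr i i p * E p j
  - \sum_i \sum_p chr p i j * E i p.

(** In [bianchi_up] for p, q, j, take the entry (p, q) and sum: two cyclic terms each contribute
    minus the divergence of Ricci, the third the derivative of the scalar curvature, once
    Christoffel terms are regrouped. *)
Lemma contracted_bianchi j : divergence ricup j + divergence ricup j = D j (\tr ricup).
Proof.
have H1 : \sum_p \sum_q (dermx p (riemup q j) + chrmx p *m riemup q j
    + riemup q j *m (chrmx p)^T) p q
  = - (\sum_p D p (ricup p j) + \sum_p \sum_a chr p p a * ricup a j).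
  have -> : \sum_p \sum_q (dermx p (riemup q j) + chrmx p *m riemup q j
    + riemup q j *m (chrmx p)^T) p q =
    \sum_p \sum_q (dermx p (riemup q j) + chrmx p *m riemup q j) p q
    + \sum_p \sum_q (riemup q j *m (chrmx p)^T) p q.
    rewrite -big_split; apply: eq_bigr => p _; rewrite -big_split.
    by apply: eq_bigr => q _; rewrite !mxE.
  (* [riemup] is skew in its upper indices and [chr] symmetric in its lower ones. *)
  rewrite [X in _ + X](_ : _ = 0) ?addr0; last first.
    rewrite exchange_big big1 // => q _.
    under eq_bigr do rewrite mxE.
    under eq_bigr do under eq_bigr do rewrite chrmx_trE.
    by apply: skew_sym_sum => a b; [exact: riemup_skewT | exact: chr_sym].
  rewrite -big_split -sumrN; apply: eq_bigr => p _.
  rewrite opprD -derN -sumrN.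
  rewrite (_ : \sum_q _ = \sum_q (D p (riemup q j p q))
     + \sum_q (chrmx p *m riemup q j) p q); last first.
    by rewrite -big_split; apply: eq_bigr => q _; rewrite !mxE.
  rewrite -der_sum; congr (D p _ + _).
    rewrite ricupE -sumrN; apply: eq_bigr => q _; exact: riemup_skewT.
  under eq_bigr do rewrite mxE.
  rewrite exchange_big; apply: eq_bigr => a _ /=.
  rewrite ricupE -mulrN -sumrN mulr_sumr; apply: eq_bigr => q _.
  by rewrite chrmxE riemup_skewT.
(* The sum of [H1] again, with p and q exchanged; the two skew-symmetries of [riemup] compensate
   each other. *)
have H2 : \sum_p \sum_q (dermx q (riemup j p) + chrmx q *m riemup j p
    + riemup j p *m (chrmx q)^T) p q
  = - (\sum_p D p (ricup p j) + \sum_p \sum_a chr p p a * ricup a j).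
  rewrite -H1 exchange_big; apply: eq_bigr => p _; apply: eq_bigr => q _.
  rewrite (_ : riemup j q = - riemup q j); last by rewrite riemup_skew.
  have -> : - riemup q j = (riemup q j)^T by rewrite riemup_tr.
  rewrite [RHS](_ : _ = (dermx p (riemup q j) + chrmx p *m riemup q j
    + riemup q j *m (chrmx p)^T)^T q p); last by rewrite [RHS]mxE.
  by move: (riemup q j) => K; rewrite !addmx_tr !trmx_mul trmxK dermx_tr addrAC.
(* Besides the derivative of the trace, this yields twice the Christoffel sum that [divergence]
   subtracts, one for each of the two copies. *)
have H3 : \sum_p \sum_q (dermx j (riemup p q) + chrmx j *m riemup p q
    + riemup p q *m (chrmx j)^T) p q
  = D j (\tr ricup) + (\sum_i \sum_p chr p i j * ricup i p
     + \sum_i \sum_p chr p i j * ricup i p).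
  rewrite (_ : \sum_p _ = \sum_p \sum_q D j (riemup p q p q)
     + (\sum_p \sum_q (chrmx j *m riemup p q) p q
     +  \sum_p \sum_q (riemup p q *m (chrmx j)^T) p q)); last first.
    rewrite -!big_split; apply: eq_bigr => p _; rewrite -!big_split.
    by apply: eq_bigr => q _; rewrite /= !addmxE dermxE addrA.
  congr (_ + (_ + _)).
  - rewrite /mxtrace der_sum exchange_big /=; apply: eq_bigr => q _.
    by rewrite ricupE der_sum.
  - rewrite [RHS]exchange_big; apply: eq_bigr => p _.
    under [LHS]eq_bigr do rewrite mxE.
    rewrite exchange_big; apply: eq_bigr => a _ /=; rewrite ricupE mulr_sumr.
    apply: eq_bigr => q _.
    by rewrite chrmxE chr_sym riemup_skew oppmxE riemup_skewT opprK.
  - rewrite exchange_big [RHS]exchange_big; apply: eq_bigr => q _.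
    under [LHS]eq_bigr do rewrite mxE.
    rewrite exchange_big; apply: eq_bigr => a _ /=; rewrite ricupE mulr_sumr.
    apply: eq_bigr => p _.
    by rewrite chrmx_trE chr_sym mulrC.
have : \sum_p \sum_q
  ((dermx p (riemup q j) + chrmx p *m riemup q j + riemup q j *m (chrmx p)^T)
  + (dermx q (riemup j p) + chrmx q *m riemup j p + riemup j p *m (chrmx q)^T)
  + (dermx j (riemup p q) + chrmx j *m riemup p q + riemup p q *m (chrmx j)^T)) p q
  = 0.
  by rewrite big1 // => p _; rewrite big1 // => q _; rewrite bianchi_up mxE.
under eq_bigr do under eq_bigr do rewrite addmxE [X in X + _]addmxE.
under eq_bigr do rewrite !big_split.
rewrite !big_split /= H1 H2 H3 => H.
apply/eqP; rewrite -subr_eq0 -oppr_eq0 -[X in _ == X]H; apply/eqP.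
rewrite /divergence; ring.
Qed.

(** * Hessian, Laplacian and the first integral *)

Definition drow f : 'rV[A]_n := \row_k D k f.

Definition hess f : 'M[A]_n :=
  \matrix_(i, j) (D i (D j f) - \sum_(k < n) chr k i j * D k f).

Definition inner f h : A := (drow f *m P *m (drow h)^T) ord0 ord0.

Definition lap f : A := \tr (P *m hess f).

Lemma hess_sym f : (hess f)^T = hess f.
Proof.
apply/matrixP => i j; rewrite !mxE derC; congr (_ - _).
by apply: eq_bigr => k _; rewrite chr_sym.
Qed.

Lemma dermx_drow i f : dermx i (drow f) = row i (hess f) + drow f *m chrmx i.
Proof.
apply/matrixP => k j; rewrite !mxE [X in _ = _ - X + _](_ : _ =
  \sum_l drow f k l * chrmx i l j) ?subrK //.
by apply: eq_bigr => l _; rewrite !mxE mulrC.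
Qed.

Lemma der_inner i f h : D i (inner f h) =
  (row i (hess f) *m P *m (drow h)^T) ord0 ord0
  + (row i (hess h) *m P *m (drow f)^T) ord0 ord0.
Proof.
have -> : row i (hess h) *m P *m (drow f)^T
    = (drow f *m P *m (row i (hess h))^T)^T.
  by rewrite !trmx_mul trmxK invmetric_sym mulmxA.
rewrite [X in _ = _ + X]mxE -addmxE /inner -dermxE; congr (fun_of_matrix _ _ _).
rewrite !dermxM dermx_tr !dermx_drow chr_invmetric.
move: (row i (hess f)) (row i (hess h)) => p q.
rewrite addmx_tr trmx_mul.
rewrite !(mulmxN, mulNmx, mulmxDl, mulmxDr, opprD) !mulmxA.
apply/matrixP => s t; rewrite !(addmxE, oppmxE) ?[RHS]mxE; ring.
Qed.

Definition grad f : 'cV[A]_n := P *m (drow f)^T.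

Lemma dermx_grad i f :
  dermx i (grad f) + chrmx i *m grad f = P *m (row i (hess f))^T.
Proof.
rewrite /grad dermxM dermx_tr dermx_drow chr_invmetric.
move: (row i (hess f)) => p.
rewrite addmx_tr trmx_mul.
rewrite !(mulmxN, mulNmx, mulmxDl, mulmxDr, opprD) !mulmxA.
apply/matrixP => s t; rewrite !(addmxE, oppmxE); ring.
Qed.

(** By [dermx_grad], E k is the covariant derivative of grad f along k, so both sides are the
    commutator of covariant derivatives applied to grad f. *)
Lemma ricci_identity i j f :
  let E k := P *m (row k (hess f))^T in
  dermx i (E j) + chrmx i *m E j - (dermx j (E i) + chrmx j *m E i)
  = riemmx i j *m grad f.
Proof.
rewrite /= -!dermx_grad; move: (grad f) => X; rewrite /riemmx.
rewrite !(dermxD, dermxM) (dermxC j i).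
rewrite !(mulmxN, mulNmx, mulmxDl, mulmxDr, opprD, opprK) !mulmxA.
apply/matrixP => s t; rewrite !(addmxE, oppmxE) ?[RHS]mxE; ring.
Qed.

(** The trace of [ricci_identity] over i and the upper index, the identity behind Bochner's
    formula. *)
Lemma div_hess f j :
  divergence (P *m hess f) j - D j (lap f) = (ricmx *m grad f) j ord0.
Proof.
have PE i k : (P *m (row k (hess f))^T) i ord0 = (P *m hess f) i k.
  by rewrite -[in RHS]hess_sym !mxE; apply: eq_bigr => l _; rewrite !mxE.
have -> : (ricmx *m grad f) j ord0 = \sum_i (riemmx i j *m grad f) i ord0.
  rewrite mxE [RHS](_ : _ = \sum_i \sum_k riem i k i j * grad f k ord0).
    rewrite exchange_big; apply: eq_bigr => k _.
    by rewrite [ricmx j k]mxE mulr_suml.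
  apply: eq_bigr => i _; rewrite mxE; apply: eq_bigr => k _.
  by rewrite riemmxE.
under [RHS]eq_bigr do rewrite -ricci_identity !addmxE oppmxE addmxE !dermxE !PE.
rewrite /divergence /lap /mxtrace der_sum sumrB !big_split opprD /= !addrA.
rewrite [LHS]addrAC; congr (_ + _ - _ - _).
- by apply: eq_bigr => i _; rewrite mxE; apply: eq_bigr => p _; rewrite chrmxE PE.
- rewrite exchange_big; apply: eq_bigr => p _.
  by rewrite mxE; apply: eq_bigr => i _; rewrite chrmxE PE chr_sym.
Qed.

Lemma divergenceZ c (B : 'M[A]_n) j :
  divergence (c *: B) j = \sum_i D i c * B i j + c * divergence B j.
Proof.
have S1 : \sum_i D i ((c *: B) i j) = \sum_i D i c * B i j + c * \sum_i D i (B i j).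
  by rewrite mulr_sumr -big_split; apply: eq_bigr => i _; rewrite mxE derM.
have S2 : \sum_i \sum_p chr i i p * (c *: B) p j
    = c * \sum_i \sum_p chr i i p * B p j.
  rewrite mulr_sumr; apply: eq_bigr => i _; rewrite mulr_sumr.
  by apply: eq_bigr => p _; rewrite mxE mulrCA.
have S3 : \sum_i \sum_p chr p i j * (c *: B) i p
    = c * \sum_i \sum_p chr p i j * B i p.
  rewrite mulr_sumr; apply: eq_bigr => i _; rewrite mulr_sumr.
  by apply: eq_bigr => p _; rewrite mxE mulrCA.
rewrite /divergence S1 S2 S3; ring.
Qed.

(** A constant multiple of the identity is parallel: its two Christoffel sums cancel. *)
Lemma divergence_shift (B : 'M[A]_n) c j : (forall i, D i c = 0) ->
  divergence (B - c%:M) j = divergence B j.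
Proof.
move=> Dc.
have Dd i : D i ((c%:M : 'M[A]_n) i j) = 0.
  by rewrite mxE; case: (_ == _); rewrite ?Dc // der0.
have C1 : \sum_i \sum_p chr i i p * (c%:M : 'M[A]_n) p j = \sum_i chr i i j * c.
  apply: eq_bigr => i _; rewrite (bigD1 j) //= mxE eqxx big1 ?addr0 // => p pj.
  by rewrite mxE (negbTE pj) mulr0.
have C2 : \sum_i \sum_p chr p i j * (c%:M : 'M[A]_n) i p = \sum_i chr i i j * c.
  apply: eq_bigr => i _; rewrite (bigD1 i) //= mxE eqxx big1 ?addr0 // => p pi.
  by rewrite mxE eq_sym (negbTE pi) mulr0.
have S1 : \sum_i D i ((B - c%:M) i j) = \sum_i D i (B i j).
  by apply: eq_bigr => i _; rewrite addmxE oppmxE derB Dd subr0.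
have S2 : \sum_i \sum_p chr i i p * (B - c%:M) p j
    = \sum_i \sum_p chr i i p * B p j - \sum_i chr i i j * c.
  rewrite -C1 -sumrB; apply: eq_bigr => i _; rewrite -sumrB.
  by apply: eq_bigr => p _; rewrite addmxE oppmxE mulrBr.
have S3 : \sum_i \sum_p chr p i j * (B - c%:M) i p
    = \sum_i \sum_p chr p i j * B i p - \sum_i chr i i j * c.
  rewrite -C2 -sumrB; apply: eq_bigr => i _; rewrite -sumrB.
  by apply: eq_bigr => p _; rewrite addmxE oppmxE mulrBr.
rewrite /divergence S1 S2 S3; ring.
Qed.

(* [div_hess] and [contracted_bianchi] give [D j (lap w)] in terms of
   [r = Ric (grad w)]; multiplying by [w] avoids any division by [w]. *)
Lemma einstein_first_integral (w m minv lam : A) :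
  m * minv = 1 ->
  (forall i, D i m = 0) -> (forall i, D i minv = 0) -> (forall i, D i lam = 0) ->
  hess w = (w * minv) *: (ricmx - lam *: G) ->
  forall j, D j (w * lap w + (m - 1) * inner w w + lam * (w * w)) = 0.
Proof.
move=> mminv Dm Dminv Dlam einstein j.
pose T := \tr ricup; pose t := T - lam * n%:R; pose b := divergence ricup j.
pose r := (ricmx *m grad w) j ord0.
have Tb : D j T = b + b by rewrite contracted_bianchi.
have PE : P *m hess w = (w * minv) *: (ricup - lam%:M).
  rewrite -hess_sym einstein linearZ /= -scalemxAr; congr (_ *: _).
  rewrite addmx_tr oppmx_tr linearZ /= GT mulmxDr mulmxN -scalemxAr PG.
  by rewrite scalemx1.
have lapE : lap w = w * minv * t.
  rewrite /lap PE linearZ /= linearB /= mxtrace_scalar /t.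
  by rewrite -[lam *+ n]mulr_natr.
have Dlap : D j (lap w) = D j w * minv * t + w * minv * (b + b).
  rewrite lapE derM derM Dminv mulr0 addr0; congr (_ + _ * _).
  rewrite /t derB Tb derM Dlam mul0r.
  have -> : D j n%:R = 0.
    by elim: n => [|k IH]; rewrite ?der0 // -addn1 natrD derD IH der1 addr0.
  by rewrite mulr0 addr0 subr0.
have rE : \sum_i D i w * ricup i j = r.
  rewrite /r mxE; under eq_bigr do rewrite mxE mulr_sumr.
  rewrite exchange_big; apply: eq_bigr => k _ /=.
  rewrite [grad w k ord0]mxE mulr_sumr; apply: eq_bigr => i _.
  by rewrite mxE [(drow w)^T _ _]mxE [drow w _ _]mxE (Psym k i) mulrCA mulrA mulrC.
(* [div_hess] for w, the divergence of (w / m) (Ric - lambda) being expanded by the Leibniz rule. *)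
have E1 : minv * (r - lam * D j w) + w * minv * b - D j (lap w) = r.
  rewrite -[RHS](div_hess w j) PE divergenceZ divergence_shift // -/b; congr (_ + _ - _).
  rewrite -rE mulrBr mulr_sumr.
  under [RHS]eq_bigr do
    rewrite derM Dminv mulr0 addr0 addmxE oppmxE mulrBr (mulrC (D _ w)) -!mulrA.
  rewrite sumrB; congr (_ - _).
  rewrite (bigD1 j) //= mxE eqxx mulr1n big1 ?addr0 => [|p pj]; first by ring.
  by rewrite mxE (negbTE pj) !mulr0.
have Din : D j (inner w w) = (w * minv) * (r - lam * D j w)
                           + (w * minv) * (r - lam * D j w).
  rewrite der_inner.
  suff -> : (row j (hess w) *m P *m (drow w)^T) ord0 ord0
      = w * minv * (r - lam * D j w) by [].
  rewrite -mulmxA -/(grad w) -row_mul mxE einstein.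
  rewrite -scalemxAl mxE; congr (_ * _).
  rewrite mulmxDl mulNmx -scalemxAl addmxE oppmxE -/r mxE; congr (_ - _ * _).
  by rewrite /grad mulmxA GP mul1mx !mxE.
rewrite !(derD, derM, derN) Dm der1 Dlam Dlap Din lapE.
have {}E1 : minv * (r - lam * D j w) - w * minv * b - minv * D j w * t = r.
  by rewrite -[RHS]E1 Dlap; ring.
(* A certificate for [ring]: dQ is 2 w times the defect of [E1] plus a multiple of 1 - m minv, and
   both vanish. *)
transitivity ((1 + 1) * w * (r
   - (minv * (r - lam * D j w) - w * minv * b - minv * D j w * t))
   + (1 - m * minv) * ((1 + 1) * w * (lam * D j w - r))).
  by move: (inner w w) => I; rewrite {E1 Tb lapE Dlap rE Din PE einstein}; clearbody t b r; ring.
by rewrite mminv E1 !subrr mulr0 mul0r addr0.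
Qed.

(** By [der_inner] each term on the right is a sum of two Hessian terms. In the signed sum those of
    a and b cancel, as in Koszul's formula for the Levi-Civita connection. *)
Lemma hess_koszul f a b :
  let T := (drow a *m P *m hess f *m P *m (drow b)^T) ord0 ord0 in
  T + T = inner a (inner f b) + inner b (inner f a) - inner f (inner a b).
Proof.
pose T f a b : A := (drow a *m P *m hess f *m P *m (drow b)^T) ord0 ord0.
have Tsym f1 a1 b1 : T f1 a1 b1 = T f1 b1 a1.
  rewrite /T -[in RHS](trmxK (drow b1 *m _ *m _ *m _ *m _)) [RHS]mxE.
  by rewrite !trmx_mul !trmxK hess_sym invmetric_sym !mulmxA.
have I f1 a1 b1 : inner a1 (inner f1 b1) = T f1 a1 b1 + T b1 a1 f1.
  rewrite /inner -addmxE.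
  rewrite -!(mulmxA (drow a1 *m P)) -mulmxDr; congr ((_ *m _) _ _).
  apply/matrixP => k l; rewrite (ord1 l) [LHS]mxE [LHS]mxE der_inner addmxE.
  by rewrite -!mulmxA -!row_mul !mxE.
move=> /=; rewrite -/(T f a b) !I (Tsym f b a) (Tsym b f a) (Tsym a f b).
rewrite (Tsym a b f); ring.
Qed.

End DifferentialRing.

(** * Smooth functions on open sets *)

Lemma continuous_at_sum (R : realType) (T : topologicalType) (I : Type)
    (r : seq I) (F : I -> T -> R) x :
  (forall i, {for x, continuous (F i)}) ->
  {for x, continuous (fun y => \sum_(i <- r) F i y)}.
Proof.
move=> cF; elim: r => [|i r IH].
  rewrite (_ : (fun y => _) = cst 0); first exact: cst_continuous.
  by apply/funext => y; rewrite big_nil.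
rewrite (_ : (fun y => _) = F i \+ (fun y => \sum_(j <- r) F j y)).
  by apply: continuousD; [exact: cF|exact: IH].
by apply/funext => y; rewrite big_cons.
Qed.

(** * Mean value theorems and differentiability of C^1 functions *)

Section MeanValue.
Variables (R : realType) (n : nat).
Implicit Types (f : 'rV[R]_n -> R) (x y z u v : 'rV[R]_n) (O : set 'rV[R]_n).

Local Notation e_ i := (basis_vec R i).

Lemma is_derive_line f z v (t : R) : derivable f (t *: v + z) v ->
  is_derive t 1 (fun s : R => f (s *: v + z)) ('D_v f (t *: v + z)).
Proof.
have E : (fun h : R => h^-1 *: (((fun s : R => f (s *: v + z)) \o shift t) (h *: 1) - f (t *: v + z)))
   = (fun h : R => h^-1 *: ((f \o shift (t *: v + z)) (h *: v) - f (t *: v + z))).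
  by apply/funext => h /=; rewrite [h *: 1]mulr1 scalerDl addrA.
by move=> df; apply: DeriveDef; rewrite /derivable /derive E.
Qed.

Lemma mean_value_line f z v (a b : R) : a < b ->
  (forall t, a <= t <= b -> derivable f (t *: v + z) v) ->
  exists2 t, a < t < b &
    f (b *: v + z) - f (a *: v + z) = (b - a) * 'D_v f (t *: v + z).
Proof.
move=> ab df.
have D1 t : a <= t <= b -> is_derive t 1 (fun s : R => f (s *: v + z)) ('D_v f (t *: v + z)).
  by move=> /df; exact: is_derive_line.
have [|//|c] := @MVT R (fun s : R => f (s *: v + z)) (fun t => 'D_v f (t *: v + z)) a b ab.
- move=> t; rewrite in_itv /= => /andP[at_ tb].
  by apply: D1; rewrite !ltW.
- apply: derivable_within_continuous => t; rewrite in_itv /= => /D1 ?.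
  exact: ex_derive.
by rewrite in_itv /= => cab ->; exists c => //; rewrite mulrC.
Qed.

Definition between (a b c : R) : bool := (a <= c <= b) || (b <= c <= a).

(** A box contains the path that changes one coordinate at a time, and it lies in the half-space as
    soon as its corners x and y do. *)
Definition box x y : set 'rV[R]_n := [set z | forall j, between (x ord0 j) (y ord0 j) (z ord0 j)].

Lemma mean_value_box f x y : (forall z, box x y z -> forall i, derivable f z (e_ i)) ->
  exists2 xi : 'I_n -> 'rV[R]_n, (forall i, box x y (xi i)) &
    f y - f x = \sum_i (y ord0 i - x ord0 i) * 'D_(e_ i) f (xi i).
Proof.
move=> df.
(* The first k coordinates come from y, the others from x, so consecutive points differ along a
   single basis vector. *)
pose hyb k : 'rV[R]_n := \row_j (if (j < k)%N then y ord0 j else x ord0 j).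
have hyb0 : hyb 0 = x by apply/rowP => j; rewrite mxE.
have hybn : hyb n = y by apply/rowP => j; rewrite mxE ltn_ord.
have hybS (i : 'I_n) : hyb i.+1 = (y ord0 i - x ord0 i) *: e_ i + hyb i.
  apply/rowP => j; rewrite !mxE eqxx /= eq_sym ltnS.
  have [<-|ij] := eqVneq i j; first by rewrite leqnn ltnn mulr1 subrK.
  by rewrite mulr0 add0r ltn_neqAle eq_sym ij.
have step (i : 'I_n) : exists2 xi, box x y xi &
    f (hyb i.+1) - f (hyb i) = (y ord0 i - x ord0 i) * 'D_(e_ i) f xi.
  have inbox t : between 0 (y ord0 i - x ord0 i) t -> box x y (t *: e_ i + hyb i).
    move=> tb j; rewrite !mxE eqxx /= eq_sym.
    have [<-|ij] := eqVneq i j; rewrite ?ltnn ?mulr1 ?mulr0 ?add0r.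
      by move: tb; rewrite /between; lra.
    by case: ifP => _; rewrite /between; lra.
  rewrite hybS; case: (ltrgtP 0 (y ord0 i - x ord0 i)) => [d0|d0|<-].
  - have [t|t td] := @mean_value_line f (hyb i) (e_ i) _ _ d0.
      by move=> tb; apply/df/inbox; rewrite /between tb.
    rewrite scale0r add0r subr0 => E.
    by exists (t *: e_ i + hyb i) => //; apply: inbox; rewrite /between; lra.
  - have [t|t td] := @mean_value_line f (hyb i) (e_ i) _ _ d0.
      by move=> tb; apply/df/inbox; rewrite /between tb orbT.
    rewrite scale0r add0r sub0r => E.
    exists (t *: e_ i + hyb i); first by apply: inbox; rewrite /between; lra.
    by rewrite -opprB E mulNr opprK.
  - exists x; first by move=> j; rewrite /between; lra.
    by rewrite scale0r add0r subrr mul0r.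
have /choice [xi xiP] : forall i : 'I_n, exists xi, box x y xi /\
    f (hyb i.+1) - f (hyb i) = (y ord0 i - x ord0 i) * 'D_(e_ i) f xi.
  by move=> i; have [xi] := step i; exists xi.
exists xi => [i|]; first by have [] := xiP i.
under eq_bigr => i _ do rewrite -(proj2 (xiP i)).
by rewrite -{1}hybn -{1}hyb0 -(telescope_sumr (fun k => f (hyb k)) (leq0n n)) big_mkord.
Qed.

Lemma box_ball x y z (r : R) : ball x r y -> box x y z -> ball x r z.
Proof.
move=> [r0 xy] bz; split=> // i j; rewrite (ord1 i).
have := xy ord0 j; have := bz j; rewrite /ball /= /between => H.
rewrite !ltr_norml; lra.
Qed.

Lemma coord_norm_le x i : `|x ord0 i| <= `|x|.
Proof. by rewrite [leRHS]/Num.Def.normr /= mx_normrE; apply: (le_bigmax _ _ (ord0, i)). Qed.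

Lemma C1_differentiable f x : (forall i, \forall y \near x, derivable f y (e_ i)) ->
  (forall i, {for x, continuous ('D_(e_ i) f)}) ->
  is_diff x f (fun v => \sum_i v ord0 i * 'D_(e_ i) f x).
Proof.
move=> df cf.
pose L v : R := \sum_i v ord0 i * 'D_(e_ i) f x.
have Llin : linear L.
  move=> a u v; rewrite /L scaler_sumr -big_split; apply: eq_bigr => i _ /=.
  by rewrite !mxE mulrDl [_ *: _]mulrA.
pose LM := GRing.isLinear.Build _ _ _ _ _ Llin.
pose LL : {linear 'rV[R]_n -> R} := HB.pack L LM.
have Lcont : continuous LL.
  move=> v; apply: continuous_at_sum => i.
  by apply: continuousM; [exact: coord_continuous | exact: cst_continuous].
suff exp : forall eps : R, 0 < eps ->
    \forall h \near (0 : 'rV[R]_n), `|f (h + x) - f x - L h| <= eps * `|h|.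
  have dE : 'd f x = LL :> ('rV[R]_n -> R).
    apply: diff_unique => //; apply/eqaddoP => eps e0.
    by apply: filterS (exp _ e0) => h; rewrite /= opprD addrA.
  apply: DiffDef; last by rewrite dE.
  apply/diff_locallyP; rewrite dE; split => //.
  apply/eqaddoP => eps e0.
  by apply: filterS (exp _ e0) => h; rewrite /= opprD addrA.
move=> _/posnumP[eps].
(* There are n error terms; dividing by n + 1 also covers n = 0. *)
have e1 : 0 < eps%:num / n.+1%:R by rewrite divr_gt0.
have H : \forall y \near x, forall i : 'I_n, derivable f y (e_ i) /\
    `|'D_(e_ i) f x - 'D_(e_ i) f y| < eps%:num / n.+1%:R.
  apply: (@filter_forall _ _ (fun (i : 'I_n) y => derivable f y (e_ i) /\
      `|'D_(e_ i) f x - 'D_(e_ i) f y| < eps%:num / n.+1%:R) _ (nbhs_filter x)) => i.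
  apply: filterI; first exact: df.
  by have /cvgrPdist_lt := cf i; apply.
move/nbhs_ballP : H => [r /= r0 Hr].
near=> h.
have bh : ball x r (h + x).
  rewrite -ball_normE /= opprD addrCA subrr addr0 normrN; near: h.
  apply/nbhs_ballP; exists r => //= k.
  by rewrite -ball_normE /= sub0r normrN.
have [|xi xib E] := @mean_value_box f x (h + x).
  by move=> z /(box_ball bh)/Hr + i => /(_ i)[].
rewrite E /L -sumrB.
apply: (@le_trans _ _ (\sum_(i < n) `|h| * (eps%:num / n.+1%:R))).
  apply: (le_trans (ler_norm_sum _ _ _)); apply: ler_sum => i _.
  rewrite !mxE addrK -mulrBr normrM; apply: ler_pM => //; first exact: coord_norm_le.
  by rewrite distrC; apply/ltW; have /Hr/(_ i)[] := box_ball bh (xib i).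
rewrite sumr_const card_ord -[leLHS]mulr_natr -mulrA mulrC; apply: ler_wpM2r => //.
rewrite -mulrA ger_pMr // mulrC ler_pdivrMr // mul1r ler_nat.
exact: leqnSn.
Unshelve. all: by end_near. Qed.

Lemma derive_curve f (gam : R -> 'rV[R]_n) :
  (forall i, \forall y \near gam 0, derivable f y (e_ i)) ->
  (forall i, {for gam 0, continuous ('D_(e_ i) f)}) ->
  (forall i, derivable (fun t : R => gam t ord0 i) (0 : R) 1) ->
  is_derive (0 : R) (1 : R) (f \o gam : R -> R)
    (\sum_i 'D_1 (fun t : R => gam t ord0 i) (0 : R) * 'D_(e_ i) f (gam 0)).
Proof.
move=> df cf dg.
have Df := C1_differentiable df cf.
have dgam : derivable gam (0 : R) 1.
  by apply/derivable_mxP => i j; rewrite (ord1 i); exact: dg.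
have Dg : differentiable gam (0 : R) by apply/derivable1_diffP.
have Dfg : differentiable (f \o gam) (0 : R) by exact: differentiable_comp.
apply: DeriveDef; first by apply/derivable1_diffP.
rewrite deriveE // diff_comp //= diff_val -deriveE //.
apply: eq_bigr => i _; rewrite derive_mx // mxE //.
Qed.

(** The left side of the equation is symmetric in u and v, which is what [schwarz] exploits. The
    mean value theorem is applied along u to the increment F, then along v to the derivative of f
    along u. *)
Lemma second_difference f x u v (h : R) : 0 < h ->
  (forall s t : R, 0 <= s <= h -> 0 <= t <= h ->
    derivable f (s *: u + (t *: v + x)) u /\
    derivable ('D_u f) (s *: u + (t *: v + x)) v) ->
  exists s t : R, [/\ 0 <= s <= h, 0 <= t <= h &
    f (h *: u + (h *: v + x)) - f (h *: u + x) - (f (h *: v + x) - f x)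
    = h * h * 'D_v ('D_u f) (s *: u + (t *: v + x))].
Proof.
move=> h0 H.
pose F z := f (h *: v + z) - f z.
have D1 z : derivable f (h *: v + z) u -> is_derive z u (fun z => f (h *: v + z)) ('D_u f (h *: v + z)).
  move=> d.
  have E : (fun k : R => k^-1 *: (((fun z => f (h *: v + z)) \o shift z) (k *: u) - f (h *: v + z)))
     = (fun k : R => k^-1 *: ((f \o shift (h *: v + z)) (k *: u) - f (h *: v + z))).
    by apply/funext => k /=; rewrite addrCA.
  by apply: DeriveDef; rewrite /derivable /derive E.
have DF s : 0 <= s <= h -> is_derive (s *: u + x) u F
    ('D_u f (h *: v + (s *: u + x)) - 'D_u f (s *: u + x)).
  move=> sh; apply: is_deriveB.
    apply: D1; rewrite addrCA; apply: (H s h sh _).1; lra.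
  have := (H s 0 sh _).1; rewrite scale0r add0r => d.
  by apply: derivableP; apply: d; lra.
have [t /DF dt|s /andP[s0 sh] E1] := @mean_value_line F x u 0 h h0.
  exact: ex_derive.
have {}sh : 0 <= s <= h by rewrite !ltW.
have [t tb|t /andP[t0 th] E2] := @mean_value_line ('D_u f) (s *: u + x) v 0 h h0.
  by rewrite addrCA; exact: (H s t sh tb).2.
exists s, t; split; [exact: sh | by rewrite (ltW t0) (ltW th) | ].
move: E1; rewrite /F scale0r add0r
  (_ : h *: v + (h *: u + x) = h *: u + (h *: v + x)); last by rewrite addrCA.
move=> ->; have [_ ->] := DF s sh.
move: E2; rewrite scale0r add0r => ->.
by rewrite subr0 mulrA addrCA.
Qed.

End MeanValue.

(** * Symmetry of second derivatives and the classes C^k *)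

Section Smooth.
Variables (R : realType) (n : nat).
Implicit Types (f g : 'rV[R]_n -> R) (x y z u v : 'rV[R]_n) (O : set 'rV[R]_n).

Local Notation e_ i := (basis_vec R i).

Lemma schwarz f x (i j : 'I_n) :
  (\forall y \near x, [/\ derivable f y (e_ i), derivable f y (e_ j),
     derivable ('D_(e_ i) f) y (e_ j) & derivable ('D_(e_ j) f) y (e_ i)]) ->
  {for x, continuous ('D_(e_ j) ('D_(e_ i) f))} ->
  {for x, continuous ('D_(e_ i) ('D_(e_ j) f))} ->
  'D_(e_ j) ('D_(e_ i) f) x = 'D_(e_ i) ('D_(e_ j) f) x.
Proof.
have tri (p q w w' d : R) : w = w' -> `|p - w| < d / 2 -> `|q - w'| < d / 2 ->
    `|p - q| <= d by move=> ->; rewrite ler_norml !ltr_norml; lra.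
move=> df c1 c2; apply/eqP; rewrite -subr_eq0 -normr_le0.
apply/ler_addgt0Pr => eps e0; rewrite add0r.
have e20 : 0 < eps / 2 by lra.
have /nbhs_ballP [r /= r0 Hr] : \forall y \near x,
    [/\ derivable f y (e_ i), derivable f y (e_ j),
     derivable ('D_(e_ i) f) y (e_ j) & derivable ('D_(e_ j) f) y (e_ i)]
   /\ (`|'D_(e_ j) ('D_(e_ i) f) x - 'D_(e_ j) ('D_(e_ i) f) y| < eps / 2
   /\ `|'D_(e_ i) ('D_(e_ j) f) x - 'D_(e_ i) ('D_(e_ j) f) y| < eps / 2).
  apply: filterI => //; apply: filterI.
    by have /cvgrPdist_lt := c1; apply.
  by have /cvgrPdist_lt := c2; apply.
(* Intermediate points are displaced by at most 2 h, which is less than r. *)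
pose h := r / 3.
have h0 : 0 < h by rewrite /h; lra.
have inball (k l : 'I_n) (s t : R) : 0 <= s <= h -> 0 <= t <= h ->
    ball x r (s *: e_ k + (t *: e_ l + x)).
  move=> sh th; split=> // a b; rewrite (ord1 a) /ball /= !mxE eqxx /=.
  rewrite addrA opprD addrCA subrr addr0 normrN.
  apply: (@le_lt_trans _ _ (s + t)); last by move: sh th; rewrite /h; lra.
  apply: (le_trans (ler_normD _ _)); rewrite !normrM.
  have B (q : bool) : `|q%:R : R| <= 1 by case: q; rewrite ?normr1 ?normr0 ?ler01.
  apply: lerD; rewrite ger0_norm; try lra;
    by rewrite ler_piMr //; lra.
have [s [t [sh th E1]]] : exists s t : R, [/\ 0 <= s <= h, 0 <= t <= h &
    f (h *: e_ i + (h *: e_ j + x)) - f (h *: e_ i + x) - (f (h *: e_ j + x) - f x)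
    = h * h * 'D_(e_ j) ('D_(e_ i) f) (s *: e_ i + (t *: e_ j + x))].
  apply: (second_difference h0) => s t sh th.
  have [[d1 _ d3 _] _] := Hr _ (inball i j s t sh th); exact: (conj d1 d3).
have [s' [t' [sh' th' E2]]] : exists s t : R, [/\ 0 <= s <= h, 0 <= t <= h &
    f (h *: e_ j + (h *: e_ i + x)) - f (h *: e_ j + x) - (f (h *: e_ i + x) - f x)
    = h * h * 'D_(e_ i) ('D_(e_ j) f) (s *: e_ j + (t *: e_ i + x))].
  apply: (second_difference h0) => s' t' sh' th'.
  have [[_ d2 _ d4] _] := Hr _ (inball j i s' t' sh' th'); exact: (conj d2 d4).
have [_ [A1 _]] := Hr _ (inball i j s t sh th).
have [_ [_ A2]] := Hr _ (inball j i s' t' sh' th').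
have E : 'D_(e_ j) ('D_(e_ i) f) (s *: e_ i + (t *: e_ j + x)) =
         'D_(e_ i) ('D_(e_ j) f) (s' *: e_ j + (t' *: e_ i + x)).
  have hh : h * h != 0 by rewrite mulf_neq0 // gt_eqF.
  apply: (mulfI hh); apply: etrans (esym E1) (etrans _ E2).
  rewrite (addrCA (h *: e_ j) (h *: e_ i)) !opprB; ring.
exact: tri E A1 A2.
Qed.

(** Grading by the order lets products and inverses be treated by induction: their derivatives
    involve the functions themselves, at one order less. *)
Fixpoint Ck k O f : Prop :=
  (forall x, O x -> {for x, continuous f}) /\
  match k with
  | 0 => True
  | k'.+1 => forall i, (forall x, O x -> derivable f x (e_ i)) /\ Ck k' O ('D_(e_ i) f)
  end.

Definition smooth O f := forall k, Ck k O f.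

Lemma Ck_le k l O f : (k <= l)%N -> Ck l O f -> Ck k O f.
Proof.
elim: k l f => [|k IH] [|l] f //= kl [cf df]; split => // i.
by have [d1 d2] := df i; split; [exact: d1 | exact: (IH l)].
Qed.

Lemma Ck_sub k O O' f : O' `<=` O -> Ck k O f -> Ck k O' f.
Proof.
move=> OO; elim: k f => [|k IH] f /= [cf df]; split.
- by move=> x /OO; exact: cf.
- by [].
- by move=> x /OO; exact: cf.
- move=> i; have [d1 d2] := df i; split; last exact: IH.
  by move=> x /OO; exact: d1.
Qed.

Lemma eq_on_near O f g x : open O -> (forall y, O y -> f y = g y) -> O x ->
  \forall y \near x, f y = g y.
Proof.
by move=> oO fg Ox; have := open_nbhs_nbhs (conj oO Ox); apply: filterS.
Qed.

Lemma near_eq_continuous f g x : (\forall y \near x, f y = g y) ->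
  {for x, continuous f} -> {for x, continuous g}.
Proof.
move=> fg cf; have fgx := nbhs_singleton fg.
rewrite /prop_for /continuous_at -fgx.
exact: cvg_trans (near_eq_cvg fg) cf.
Qed.

Lemma Ck_ext k O f g : open O -> (forall y, O y -> f y = g y) ->
  Ck k O f -> Ck k O g.
Proof.
move=> oO; elim: k f g => [|k IH] f g fg /= [cf df].
  by split=> // x Ox; apply: near_eq_continuous (cf x Ox); exact: (eq_on_near oO).
split=> [x Ox|i]; first by apply: near_eq_continuous (cf x Ox); exact: (eq_on_near oO).
have [d1 d2] := df i; split.
  move=> x Ox; apply: near_eq_derivable (d1 x Ox).
  exact: (eq_on_near oO fg Ox).
apply: IH d2 => x Ox; apply: near_eq_derive.
exact: (eq_on_near oO fg Ox).
Qed.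

Lemma Ck_cst k O (c : R) : open O -> Ck k O (cst c).
Proof.
move=> oO; elim: k c => [|k IH] c /=; split => //; try by move=> x _; exact: cst_continuous.
move=> i; split; first by move=> x _; exact: derivable_cst.
by apply: Ck_ext (IH 0) => // y _; rewrite derive_cst.
Qed.

Lemma CkD k O f g : open O -> Ck k O f -> Ck k O g -> Ck k O (f \+ g).
Proof.
move=> oO; elim: k f g => [|k IH] f g /= [cf df] [cg dg]; split => //;
  try by move=> x Ox; apply: continuousD; [exact: cf|exact: cg].
move=> i; have [f1 f2] := df i; have [g1 g2] := dg i; split.
  by move=> x Ox; apply: derivableD; [exact: f1|exact: g1].
apply: Ck_ext (IH _ _ f2 g2) => // y Oy /=.
by rewrite -deriveD //; [exact: f1|exact: g1].
Qed.

Lemma CkM k O f g : open O -> Ck k O f -> Ck k O g -> Ck k O (f \* g).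
Proof.
move=> oO; elim: k f g => [|k IH] f g Hf Hg; move: (Hf) (Hg) => [cf df] [cg dg]; split => //;
  try by move=> x Ox; apply: continuousM; [exact: cf|exact: cg].
move=> i; have [f1 f2] := df i; have [g1 g2] := dg i; split.
  by move=> x Ox; apply: derivableM; [exact: f1|exact: g1].
have Hf' := Ck_le (leqnSn k) Hf; have Hg' := Ck_le (leqnSn k) Hg.
apply: Ck_ext (CkD oO (IH _ _ Hf' g2) (IH _ _ Hg' f2)) => // y Oy /=.
by rewrite -deriveM //; [exact: f1|exact: g1].
Qed.

Lemma CkN k O f : open O -> Ck k O f -> Ck k O (\- f).
Proof.
move=> oO Hf; apply: Ck_ext (CkM oO (Ck_cst k (-1) oO) Hf) => // y _ /=.
by rewrite mulN1r.
Qed.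

Lemma CkV k O f : open O -> (forall x, O x -> f x != 0) -> Ck k O f ->
  Ck k O (fun x => (f x)^-1).
Proof.
move=> oO f0; elim: k => [|k IH] Hf; move: (Hf) => [cf df]; split => //;
  try by move=> x Ox; apply: continuousV; [exact: f0|exact: cf].
move=> i; have [f1 f2] := df i; split.
  by move=> x Ox; apply: derivableV; [exact: f0|exact: f1].
have HV := IH (Ck_le (leqnSn k) Hf).
apply: Ck_ext (CkM oO (CkN oO (CkM oO HV HV)) f2) => // y Oy /=.
by rewrite deriveV; [rewrite expr2 invfM|exact: f0|exact: f1].
Qed.

(** [iter_partial] differentiates first along the last entry of the list, while [Ck] peels off the
    first derivative taken; hence the induction on the right end. *)
Lemma smooth_openP O f : smooth_open O f <-> smooth O f.
Proof.
split=> [Sf k|Sf s].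
  elim: k f Sf => [|k IH] f Sf /=.
    by split=> // x Ox; exact: (Sf [::] x Ox).1.
  split=> [x Ox|i]; first exact: (Sf [::] x Ox).1.
  split; first by move=> x Ox; exact: (Sf [::] x Ox).2.
  apply: IH => s x Ox; have := Sf (rcons s i) x Ox.
  by rewrite /iter_partial foldr_rcons.
elim/last_ind: s f Sf => [|s i IH] f Sf x Ox.
  have [cf df] := Sf 1%N; split; first exact: cf.
  by move=> i; have [d _] := df i; exact: d.
rewrite /iter_partial foldr_rcons; apply: IH => // k.
by have [_ /(_ i)[]] := Sf k.+1.
Qed.

Lemma smooth_continuous O f x : smooth O f -> O x -> {for x, continuous f}.
Proof. by move=> /(_ 0)[+ _]; apply. Qed.

Lemma smooth_derivable O f x i : smooth O f -> O x -> derivable f x (e_ i).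
Proof. by move=> /(_ 1%N)[_ /(_ i)[+ _]]; apply. Qed.

Lemma smooth_derive O f i : smooth O f -> smooth O ('D_(e_ i) f).
Proof. by move=> Sf k; have [_ /(_ i)[]] := Sf k.+1. Qed.

Lemma smooth_sub O O' f : O' `<=` O -> smooth O f -> smooth O' f.
Proof. by move=> OO Sf k; exact: Ck_sub (Sf k). Qed.

Lemma smooth_near_derivable O f x i : open O -> smooth O f -> O x ->
  \forall y \near x, derivable f y (e_ i).
Proof.
move=> oO Sf Ox; have := open_nbhs_nbhs (conj oO Ox); apply: filterS => y.
exact: smooth_derivable.
Qed.

Lemma smooth_schwarz O f x i j : open O -> smooth O f -> O x ->
  'D_(e_ j) ('D_(e_ i) f) x = 'D_(e_ i) ('D_(e_ j) f) x.
Proof.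
move=> oO Sf Ox; apply: schwarz.
- have := open_nbhs_nbhs (conj oO Ox); apply: filterS => y Oy.
  have d k : derivable f y (e_ k) by exact: smooth_derivable Sf Oy.
  have dd k l : derivable ('D_(e_ k) f) y (e_ l).
    exact: smooth_derivable (smooth_derive k Sf) Oy.
  by split; [exact: d | exact: d | exact: dd | exact: dd].
- exact: smooth_continuous (smooth_derive _ (smooth_derive _ Sf)) Ox.
- exact: smooth_continuous (smooth_derive _ (smooth_derive _ Sf)) Ox.
Qed.

Lemma smooth_is_diff O f x : open O -> smooth O f -> O x ->
  is_diff x f (fun v => \sum_i v ord0 i * 'D_(e_ i) f x).
Proof.
move=> oO Sf Ox; apply: C1_differentiable => i.
  exact: smooth_near_derivable Ox.
exact: smooth_continuous (smooth_derive _ Sf) Ox.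
Qed.

Lemma smooth_is_derive O f x v : open O -> smooth O f -> O x ->
  is_derive x v f (\sum_i v ord0 i * 'D_(e_ i) f x).
Proof.
move=> oO Sf Ox; have D := smooth_is_diff oO Sf Ox.
have d : differentiable f x by exact: ex_diff.
by apply: DeriveDef; [exact: diff_derivable | rewrite deriveE // diff_val].
Qed.

End Smooth.

(** * The strong maximum principle *)

(** Induction by splitting off a square: P is a rank-one term u^T u / a plus its Schur complement
    C', which is again symmetric and positive definite. *)
Lemma trace_posdef_le0 (R : realFieldType) n (P H : 'M[R]_n) :
  P^T = P -> (forall v : 'rV_n, v != 0 -> 0 < (v *m P *m v^T) ord0 ord0) ->
  (forall v : 'rV_n, (v *m H *m v^T) ord0 ord0 <= 0) -> \tr (P *m H) <= 0.
Proof.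
elim: n P H => [|n IH] P H; first by move=> *; rewrite /mxtrace big_ord0.
rewrite -[n.+1]/(1 + n)%N in P H * => PT Ppos Hneg.
pose a := P ord0 ord0; pose b : 'rV_n := ursubmx P; pose C := drsubmx P.
pose u : 'rV_(1 + n) := row_mx a%:M b; pose C' := C - a^-1 *: (b^T *m b).
have PE : P = block_mx a%:M b b^T C.
  rewrite -[LHS](submxK P) /b trmx_ursub PT; congr (block_mx _ _ _ _).
  by apply/matrixP => i j; rewrite (ord1 i) (ord1 j) !mxE eqxx; congr (P _ _); apply/val_inj.
have a0 : 0 < a.
  have := Ppos (delta_mx ord0 ord0).
  rewrite -rowE trmx_delta -colE !mxE; apply.
  by apply/eqP => /matrixP/(_ ord0 ord0); rewrite !mxE => /eqP; rewrite oner_eq0.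
have PE' : P = a^-1 *: (u^T *m u) + block_mx 0 0 0 C'.
  rewrite PE /u tr_row_mx mul_col_row scale_block_mx add_block_mx.
  rewrite tr_scalar_mx -scalar_mxM mul_scalar_mx mul_mx_scalar !scalerA mulVf ?gt_eqF //.
  by rewrite !scale1r !addr0 scale_scalar_mx mulrA mulVf ?gt_eqF // mul1r /C' addrC subrK.
have -> : \tr (P *m H) = a^-1 * (u *m H *m u^T) ord0 ord0 + \tr (C' *m drsubmx H).
  rewrite {1}PE' mulmxDl mxtraceD -scalemxAl mxtraceZ; congr (_ * _ + _).
    by rewrite -mulmxA mxtrace_mulC /mxtrace big_ord1.
  rewrite -[in LHS](submxK H) mulmx_block mxtrace_block !mul0mx !add0r.
  by rewrite mxtrace0 add0r.
(* w completes v to a vector orthogonal to u, on which the rank-one part of P vanishes. *)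
have vC' (v : 'rV_n) : let w := row_mx (- (a^-1 *: (v *m b^T))) v in
    w *m P *m w^T = v *m C' *m v^T.
  move=> w; have wu : w *m u^T = 0.
    rewrite /w /u tr_row_mx mul_row_col tr_scalar_mx mulNmx mul_mx_scalar scalerA.
    by rewrite mulfV ?gt_eqF // scale1r addNr.
  rewrite PE' mulmxDr mulmxDl -scalemxAr (mulmxA w) wu mul0mx scaler0 mul0mx add0r.
  by rewrite /w mul_row_block tr_row_mx mul_row_col !mulmx0 !add0r mul0mx add0r.
have CT : C'^T = C'.
  rewrite /C' linearB /= linearZ /= trmx_mul trmxK; congr (_ - _).
  by rewrite /C trmx_drsub PT.
rewrite -[leRHS]addr0; apply: lerD; first by apply: mulr_ge0_le0 => //; rewrite invr_ge0 ltW.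
apply: IH => //.
  move=> v v0; rewrite -vC'; apply: Ppos; apply: contra_neq v0 => /eqP.
  by rewrite row_mx_eq0 => /andP[_ /eqP].
move=> v; have := Hneg (row_mx 0 v).
rewrite -[in X in X -> _](submxK H) mul_row_block tr_row_mx mul_row_col.
by rewrite !mul0mx trmx0 mulmx0 !add0r.
Qed.

Section MaximumPrinciple.
Variables (R : realType) (n : nat).
Implicit Types (f g : 'rV[R]_n -> R) (x y z u v : 'rV[R]_n) (O : set 'rV[R]_n).

Local Notation e_ i := (basis_vec R i).

Definition second_partials f x : 'M[R]_n := \matrix_(i, j) 'D_(e_ i) ('D_(e_ j) f) x.

Lemma open_line O x v : open O -> O x ->
  exists2 d : R, 0 < d & forall t, `|t| < d -> O (t *: v + x).
Proof.
move=> oO Ox.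
have c : {for (0 : R), continuous (fun t : R => t *: v + x)}.
  by apply: continuousD; [exact: scalel_continuous | exact: cst_continuous].
have : nbhs (0 : R) [set t : R | O (t *: v + x)].
  by apply: c; rewrite scale0r add0r; exact: open_nbhs_nbhs.
move=> /nbhs_ballP[d /= d0 H]; exists d => // t td; apply: H.
by rewrite -ball_normE /= sub0r normrN.
Qed.

Lemma smooth_max O f x : open O -> smooth O f -> O x ->
  (forall y, O y -> f y <= f x) ->
  (forall i, 'D_(e_ i) f x = 0) /\ forall v, (v *m second_partials f x *m v^T) ord0 ord0 <= 0.
Proof.
move=> oO Sf Ox fmax.
have crit v : \sum_j v ord0 j * 'D_(e_ j) f x = 0.
  have [d d0 Od] := open_line v oO Ox.
  have := @derive1_at_max _ (fun t : R => f (t *: v + x)) (- d) d 0.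
  have D t : t \in `]- d, d[ -> is_derive t 1 (fun t : R => f (t *: v + x)) ('D_v f (t *: v + x)).
    rewrite in_itv /= -ltr_norml => /Od Ot; apply: is_derive_line.
    by have := smooth_is_derive v oO Sf Ot; move=> ?; exact: ex_derive.
  case.
  - lra.
  - by move=> t /D ?; exact: ex_derive.
  - by rewrite in_itv /=; lra.
  - move=> t; rewrite in_itv /= -ltr_norml => /Od Ot.
    by rewrite scale0r add0r; exact: fmax.
  move=> _ E.
  have /D D0 : (0 : R) \in `]- d, d[ by rewrite in_itv /=; lra.
  have := @derive_val _ _ _ _ _ _ _ D0; rewrite E scale0r add0r => /esym H.
  have [_ <-] := smooth_is_derive v oO Sf Ox; exact: H.
split.
  move=> i; rewrite -[RHS](crit (e_ i)) (bigD1 i) //= !mxE !eqxx mul1r.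
  by rewrite big1 ?addr0 // => j ji; rewrite !mxE eqxx (negbTE ji) mul0r.
move=> v.
pose g : 'rV[R]_n -> R := \sum_(j < n) (v ord0 j *: 'D_(e_ j) f).
have gE y : g y = \sum_j v ord0 j * 'D_(e_ j) f y by rewrite /g fct_sumE.
have dg y : O y -> is_derive y v g (\sum_(j < n) v ord0 j * 'D_v ('D_(e_ j) f) y).
  move=> Oy; apply: is_derive_sum => j; apply: is_deriveZ.
  have [? ?] := smooth_is_derive v oO (smooth_derive j Sf) Oy.
  exact: derivableP.
have D2 : 'D_v g x = (v *m second_partials f x *m v^T) ord0 ord0.
  have [_ ->] := dg _ Ox; rewrite !mxE; apply: eq_bigr => j _.
  have [_ ->] := smooth_is_derive v oO (smooth_derive j Sf) Ox.
  by rewrite !mxE mulrC; congr (_ * _); apply: eq_bigr => i _; rewrite !mxE.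
(* Were the second derivative along v positive, the first derivative g, zero at x, would be positive
   just beyond x, and the mean value theorem would give a value of f above the maximum. *)
rewrite -D2 leNgt; apply/negP => c0.
have [d d0 Od] := open_line v oO Ox.
have dgx : derivable g x v by have [] := dg _ Ox.
have Hnear : \forall h \near (0 : R)^', 0 < h^-1 *: (g (h *: v + x) - g x).
  have : (fun h : R => h^-1 *: (g (h *: v + x) - g x)) @ 0^' --> 'D_v g x by exact: dgx.
  move=> /cvgrPdist_lt/(_ _ c0); apply: filterS => h.
  by move: (h^-1 *: _) ('D_v g x) => p q; rewrite ltr_norml; lra.
have [r r0 Hr] : exists2 r : R, 0 < r & forall h, 0 < h < r -> 0 < g (h *: v + x).
  move: Hnear; rewrite near_withinE => /nbhs_ballP[r /= r0 Hr]; exists r => // h /andP[h0 hr].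
  have := Hr h; rewrite -ball_normE /= sub0r normrN gtr0_norm // => /(_ hr).
  rewrite gt_eqF // => /(_ isT); rewrite [g x]gE crit subr0.
  by rewrite pmulr_rgt0 // invr_gt0.
have [t [t0 tr td]] : exists t : R, [/\ 0 < t, t < r & t < d].
  have m0 : 0 < Num.min r d by rewrite lt_min r0 d0.
  have mr : Num.min r d <= r by rewrite ge_min lexx.
  have md : Num.min r d <= d by rewrite ge_min lexx orbT.
  by exists (Num.min r d / 2); move: (Num.min r d) m0 mr md => q *; split; lra.
have Ot s : 0 <= s <= t -> O (s *: v + x).
  by move=> st; apply: Od; rewrite ger0_norm; lra.
have [s st|s st E] := @mean_value_line R n f x v 0 t t0.
  by have [] := smooth_is_derive v oO Sf (Ot s st).
have {}st' : 0 <= s <= t by lra.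
have [_ DE] := smooth_is_derive v oO Sf (Ot s st').
have gs : 0 < g (s *: v + x) by apply: Hr; lra.
have : f (t *: v + x) <= f x by apply/fmax/Ot; lra.
rewrite leNgt => /negP; apply; rewrite -subr_gt0.
move: E; rewrite scale0r add0r subr0 => ->.
by rewrite mulr_gt0 // DE -gE.
Qed.

End MaximumPrinciple.

(** * The barrier and its derivatives *)

Section Barrier.
Variables (R : realType) (n : nat).
Implicit Types (f g : 'rV[R]_n -> R) (x z v y : 'rV[R]_n) (O : set 'rV[R]_n).

Local Notation e_ i := (basis_vec R i).

Lemma is_derive_coord x v (i : 'I_n) : is_derive x v (fun z : 'rV[R]_n => z ord0 i) (v ord0 i).
Proof.
have d : differentiable (fun z : 'rV[R]_n => z ord0 i) x by exact: differentiable_coord.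
apply: DeriveDef; first exact: diff_derivable.
apply: lim_near_cst => //=; near=> h.
rewrite !mxE addrK [_ *: _]mulKf //; near: h; exact: nbhs_dnbhs_neq.
Unshelve. all: by end_near. Qed.

Lemma smooth_ext O f g : open O -> (forall x, O x -> f x = g x) -> smooth O f -> smooth O g.
Proof. by move=> oO fg Sf k; exact: Ck_ext (Sf k). Qed.

Lemma smooth_cst O (c : R) : open O -> smooth O (cst c).
Proof. by move=> oO k; exact: Ck_cst. Qed.

Lemma smoothD O f g : open O -> smooth O f -> smooth O g -> smooth O (f \+ g).
Proof. by move=> oO Sf Sg k; exact: CkD. Qed.

Lemma smoothM O f g : open O -> smooth O f -> smooth O g -> smooth O (f \* g).
Proof. by move=> oO Sf Sg k; exact: CkM. Qed.

Lemma smoothN O f : open O -> smooth O f -> smooth O (\- f).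
Proof. by move=> oO Sf k; exact: CkN. Qed.

Lemma smoothV O f : open O -> (forall x, O x -> f x != 0) -> smooth O f ->
  smooth O (fun x => (f x)^-1).
Proof. by move=> oO f0 Sf k; exact: CkV. Qed.

Lemma smoothX O f N : open O -> smooth O f -> smooth O (fun x => f x ^+ N).
Proof.
move=> oO Sf; elim: N => [|N IH]; first exact: smooth_cst.
by apply: smooth_ext (smoothM oO Sf IH) => // x _; rewrite exprS.
Qed.

Lemma smooth_sum O (I : Type) (r : seq I) (F : I -> 'rV[R]_n -> R) : open O ->
  (forall i, smooth O (F i)) -> smooth O (fun x => \sum_(i <- r) F i x).
Proof.
move=> oO SF; elim: r => [|i r IH].
  by apply: smooth_ext (smooth_cst 0 oO) => // x _; rewrite big_nil.
by apply: smooth_ext (smoothD oO (SF i) IH) => // x _; rewrite big_cons.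
Qed.

Lemma smooth_coord O (i : 'I_n) : open O -> smooth O (fun z => z ord0 i).
Proof.
move=> oO; case=> [|k] /=; split => //; try by move=> x _; exact: coord_continuous.
move=> j; split; first by move=> x _; have [] := is_derive_coord x (e_ j) i.
apply: Ck_ext (Ck_cst k (e_ j ord0 i) oO) => // x _.
by have [_ ->] := is_derive_coord x (e_ j) i.
Qed.

Variables (y : 'rV[R]_n) (T : R).

(** The squared Euclidean distance to y, smooth, whereas [ball] refers to the sup norm; [dist2_ball]
    relates the two. *)
Definition dist2 z : R := \sum_i (z ord0 i - y ord0 i) ^+ 2.

Lemma smooth_dist2 O : open O -> smooth O dist2.
Proof.
move=> oO; apply: smooth_sum => // i; apply: smoothX => //.
apply: smoothD => //; [exact: smooth_coord | exact: smooth_cst].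
Qed.

Lemma dist2_ge0 z : 0 <= dist2 z.
Proof. by apply: sumr_ge0 => i _; rewrite sqr_ge0. Qed.

Lemma dist2_ball z (r : R) : 0 < r -> dist2 z < r ^+ 2 -> ball y r z.
Proof.
move=> r0 zr; split => // i j; rewrite (ord1 i) /ball /= distrC.
rewrite -(@ltr_pXn2r _ 2) ?nnegrE ?(ltW r0) // real_normK ?num_real //.
apply: le_lt_trans zr; rewrite /dist2 (bigD1 j) //= lerDl.
by apply: sumr_ge0 => k _; rewrite sqr_ge0.
Qed.

Lemma dist2_continuous : continuous dist2.
Proof.
by move=> x; apply: (@smooth_continuous _ _ setT); [apply: smooth_dist2; exact: openT|].
Qed.

(** It replaces the exponential of Hopf's lemma: it vanishes on the sphere [dist2] = T, a large N
    plays the part of the large rate, and its derivatives stay polynomial. *)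
Definition barrier (N : nat) z : R := (T - dist2 z) ^+ N.

Lemma smooth_barrier O N : open O -> smooth O (barrier N).
Proof.
move=> oO; apply: smoothX => //; apply: smoothD => //; first exact: smooth_cst.
by apply: smoothN => //; exact: smooth_dist2.
Qed.

Lemma is_derive_dist2 x v : is_derive x v dist2 (\sum_i 2 * (x ord0 i - y ord0 i) * v ord0 i).
Proof.
have -> : dist2 = \sum_(i < n) ((fun z : 'rV[R]_n => z ord0 i) - cst (y ord0 i)) ^+ 2.
  by rewrite fct_sumE.
apply: is_derive_sum => i.
have D : is_derive x v ((fun z : 'rV[R]_n => z ord0 i) - cst (y ord0 i)) (v ord0 i - 0).
  by apply: is_deriveB; exact: is_derive_coord.
apply: is_derive_eq; rewrite subr0 expr1 /=.
by rewrite [_ *: _]mulrC mulrC -mulr_natl.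
Qed.

Lemma derive_barrier x N (i : 'I_n) : 'D_(e_ i) (barrier N.+1) x =
  - 2 * N.+1%:R * (x ord0 i - y ord0 i) * barrier N x.
Proof.
have Ds : is_derive x (e_ i) (cst T - dist2) (0 - \sum_j 2 * (x ord0 j - y ord0 j) * e_ i ord0 j).
  by apply: is_deriveB; exact: is_derive_dist2.
have -> : barrier N.+1 = (cst T - dist2) ^+ N.+1 by apply/funext => z; rewrite fctE.
have [_ ->] := is_deriveX N.+1 Ds.
rewrite sub0r (bigD1 i) //= big1 => [|j ji]; last by rewrite !mxE eqxx (negbTE ji) mulr0.
by rewrite !mxE !eqxx addr0 mulr1 /barrier /= [_ *: _]mulrC; ring.
Qed.

Lemma second_derive_barrier x N (i j : 'I_n) : 'D_(e_ i) ('D_(e_ j) (barrier N.+2)) x =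
  4 * N.+2%:R * N.+1%:R * (x ord0 i - y ord0 i) * (x ord0 j - y ord0 j) * barrier N x
  - 2 * N.+2%:R * (i == j)%:R * barrier N.+1 x.
Proof.
pose X : 'rV[R]_n -> R := (fun z : 'rV[R]_n => z ord0 j) - cst (y ord0 j).
have -> : 'D_(e_ j) (barrier N.+2) = (- 2 * N.+2%:R) *: (X * barrier N.+1).
  by apply/funext => z; rewrite derive_barrier -mulrA.
have DX : is_derive x (e_ i) X ((i == j)%:R - 0).
  have -> : (i == j)%:R = e_ i ord0 j :> R by rewrite !mxE eqxx eq_sym.
  by apply: is_deriveB; exact: is_derive_coord.
have dB : derivable (barrier N.+1) x (e_ i).
  by apply: (@smooth_derivable _ _ setT) => //; apply: smooth_barrier; exact: openT.
have DB := derivableP dB; rewrite derive_barrier in DB.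
have [_ ->] := is_deriveZ (- 2 * N.+2%:R) (is_deriveM DX DB).
have -> : X x = x ord0 j - y ord0 j by [].
rewrite subr0 ![_ *: _]mulrC; move: (barrier N x) (barrier N.+1 x) => B1 B2; ring.
Qed.

End Barrier.

(** * Hopf's comparison argument *)

Section StrongMaximum.
Variables (R : realType) (n : nat).
Implicit Types (f g : 'rV[R]_n -> R) (x z y : 'rV[R]_n) (O : set 'rV[R]_n).

Local Notation e_ i := (basis_vec R i).

Definition partials f x : 'rV[R]_n := \row_k 'D_(e_ k) f x.

Lemma smooth_deriveDZ O f g c x i : open O -> smooth O f -> smooth O g -> O x ->
  'D_(e_ i) (fun z => f z + c * g z) x = 'D_(e_ i) f x + c * 'D_(e_ i) g x.
Proof.
move=> oO Sf Sg Ox.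
have df : derivable f x (e_ i) by exact: smooth_derivable Sf Ox.
have dg : derivable g x (e_ i) by exact: smooth_derivable Sg Ox.
have [_ E] := is_deriveD (derivableP df) (is_deriveZ c (derivableP dg)).
exact: E.
Qed.

Lemma smooth_partialsDZ O f g c x : open O -> smooth O f -> smooth O g -> O x ->
  partials (fun z => f z + c * g z) x = partials f x + c *: partials g x.
Proof.
by move=> oO Sf Sg Ox; apply/rowP => k; rewrite !mxE (smooth_deriveDZ c _ oO).
Qed.

Lemma smooth_second_partialsDZ O f g c x : open O -> smooth O f -> smooth O g -> O x ->
  second_partials (fun z => f z + c * g z) x = second_partials f x + c *: second_partials g x.
Proof.
move=> oO Sf Sg Ox; apply/matrixP => i j; rewrite !mxE.
rewrite -(smooth_deriveDZ c i oO (smooth_derive j Sf) (smooth_derive j Sg) Ox).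
apply: near_eq_derive; apply: (eq_on_near oO) Ox => z Oz.
exact: (smooth_deriveDZ c j oO).
Qed.

Lemma exists_small (a b d c : R) : 0 <= a -> 0 <= b -> 0 < d -> 0 < c ->
  exists e : R, [/\ 0 < e, e * a <= d & e * b < c].
Proof.
move=> a0 b0 d0 c0; exists (Num.min (d / (a + 1)) (c / (b + 1))).
have A1 : 0 < a + 1 by lra.
have B1 : 0 < b + 1 by lra.
have Da : d / (a + 1) * (a + 1) = d by rewrite divfK // gt_eqF.
have Db : c / (b + 1) * (b + 1) = c by rewrite divfK // gt_eqF.
have da : 0 < d / (a + 1) by rewrite divr_gt0.
have db : 0 < c / (b + 1) by rewrite divr_gt0.
have m1 : Num.min (d / (a + 1)) (c / (b + 1)) <= d / (a + 1) by rewrite ge_min lexx.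
have m2 : Num.min (d / (a + 1)) (c / (b + 1)) <= c / (b + 1) by rewrite ge_min lexx orbT.
split; first by rewrite lt_min da db.
  apply: (le_trans (ler_wpM2r a0 m1)); move: (d / (a + 1)) Da da => q *; nra.
apply: (le_lt_trans (ler_wpM2r b0 m2)); move: (c / (b + 1)) Db db => q *; nra.
Qed.

(* Evaluates the equation at a maximum of [f + ep * barrier]: [p] and [K] are
   [|z - y|^2] and the remaining first-order coefficient in the metric [P], [s] is
   [T] minus the Euclidean [|z - y|^2], and [trv] is the trace of [P] times the
   second derivatives of [f + ep * barrier]. *)
Lemma barrier_inequality (k : nat) (m f c p K s T ep trv : R) : 1 <= m ->
  0 < c <= f -> 0 < p -> 0 < s <= T -> T * `|K| / (2 * p) <= k%:R -> 0 < ep ->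
  ep * ((m - 1) * k.+2%:R * T ^+ k.+2) < c -> trv <= 0 ->
  f * (trv - ep * (4 * k.+2%:R * k.+1%:R * s ^+ k * p - 2 * k.+2%:R * s ^+ k.+1 * K))
  + (m - 1) * ep ^+ 2 * (4 * k.+2%:R ^+ 2 * s ^+ k.+1 ^+ 2 * p) = 0 -> False.
Proof.
move=> m1 /andP[c0 cf] p0 /andP[s0 sT] Kk ep0 epc trv0 E.
have T0 : 0 < T by exact: lt_le_trans sT.
(* The lower bound on k makes the second-order term absorb the first-order one; what is left over is
   at least W, by [L1]. *)
have sK : s * K <= 2 * k%:R * p.
  apply: (@le_trans _ _ (T * `|K|)).
    apply: (@le_trans _ _ (s * `|K|)); first by apply: ler_wpM2l; [exact: ltW | exact: ler_norm].
    exact: ler_wpM2r.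
  by move: Kk; rewrite ler_pdivrMr ?mulr_gt0 // mulrCA mulrA.
pose N : R := k.+2%:R; pose S := s ^+ k.
have N0 : 0 < N by rewrite ltr0n.
have S0 : 0 < S by exact: exprn_gt0.
have NE : k.+1%:R = k%:R + 1 :> R by rewrite -natr1.
have sSE : s ^+ k.+1 = s * S by rewrite exprS.
pose W := 4 * N * S * p.
have W0 : 0 < W by rewrite !mulr_gt0.
have L1 : W <= 4 * N * k.+1%:R * S * p - 2 * N * (s * S) * K.
  rewrite -subr_ge0 (_ : _ - W = 2 * N * S * (2 * k%:R * p - s * K)).
    by rewrite mulr_ge0 // ?subr_ge0 // !mulr_ge0 ?ltW.
  by rewrite /W NE; ring.
move: E; rewrite sSE -/N -/S; set L := (X in f * (trv - ep * X)) => E.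
have E1 : ep * (f * L) = f * trv + (m - 1) * ep ^+ 2 * (4 * N ^+ 2 * (s * S) ^+ 2 * p).
  by apply/eqP; rewrite -subr_eq0 -oppr_eq0; apply/eqP; rewrite -[RHS]E; ring.
have ft : f * trv <= 0 by rewrite mulr_ge0_le0 //; lra.
(* The left side is linear in ep and the gradient term on the right quadratic; after division by ep
   W this bounds c by a quantity that the choice of ep keeps below c. *)
have E2 : ep * (c * W) <= ep * ((m - 1) * ep * N * (s ^+ k.+2) * W).
  apply: (@le_trans _ _ (ep * (f * L))).
    apply: ler_wpM2l; first exact: ltW.
    by apply: ler_pM => //; exact: ltW.
  have -> : ep * ((m - 1) * ep * N * (s ^+ k.+2) * W) =
    (m - 1) * ep ^+ 2 * (4 * N ^+ 2 * (s * S) ^+ 2 * p).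
    by rewrite /W !exprS -/S; ring.
  by rewrite E1; move: ft; move: (f * trv) => ?; lra.
have E3 : c <= (m - 1) * ep * N * (s ^+ k.+2).
  by rewrite -(ler_pM2r W0) -(ler_pM2l ep0).
have E4 : (m - 1) * ep * N * (s ^+ k.+2) <= (m - 1) * ep * N * (T ^+ k.+2).
  apply: ler_wpM2l; last by rewrite lerXn2r // nnegrE ltW.
  by rewrite !mulr_ge0 ?subr_ge0 // ltW.
have := le_lt_trans (le_trans E3 E4); move=> /(_ c); rewrite ltxx => H.
by have : false by apply: H; move: epc; rewrite -/N; congr (_ < _); ring.
Qed.

(** Write L for the operator with coefficients P and b. Where f > 0 the equation says L (f^m) = 0,
    since L (f^m) is m f^(m-2) times its left side. *)
Theorem strong_maximum (m : R) O f x0 (P : 'rV[R]_n -> 'M[R]_n) (b : 'rV[R]_n -> 'rV[R]_n) :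
  1 <= m -> open O -> smooth O f -> O x0 -> 0 < f x0 ->
  (forall x, O x -> f x <= f x0) ->
  (forall x, O x -> (P x)^T = P x) ->
  (forall x, O x -> forall v : 'rV_n, v != 0 -> 0 < (v *m P x *m v^T) ord0 ord0) ->
  (forall x i j, O x -> {for x, continuous (fun z => P z i j)}) ->
  (forall x i, O x -> {for x, continuous (fun z => b z ord0 i)}) ->
  (forall x, O x ->
    f x * (\tr (P x *m second_partials f x) + (b x *m (partials f x)^T) ord0 ord0)
    + (m - 1) * (partials f x *m P x *m (partials f x)^T) ord0 ord0 = 0) ->
  \forall x \near x0, f x = f x0.
Proof.
have alg (F e N N1 S0 S1 p tP be t1 t2 : R) :
    t2 = t1 + e * (4 * N * N1 * S0 * p - 2 * N * S1 * tP) ->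
    F * (t1 + 2 * e * N * S1 * be) + (m - 1) * ((2 * e * N * S1) ^+ 2 * p) = 0 ->
    F * (t2 - e * (4 * N * N1 * S0 * p - 2 * N * S1 * (tP + be)))
    + (m - 1) * e ^+ 2 * (4 * N ^+ 2 * S1 ^+ 2 * p) = 0.
  by move=> -> H; rewrite -[RHS]H; ring.
move=> m1 oO Sf Ox0 fx0 fmax PT Ppos Pc bc E.
(* If [f y < f x0] for some [y] close to [x0], compare [f] with the barrier centred
   at [y] on the annulus [A] with outer radius [2 r], which contains [x0]. *)
have [r r0 Hr] : exists2 r : R, 0 < r & forall x, ball x0 (4 * r) x -> O x /\ f x0 / 2 < f x.
  have : \forall x \near x0, O x /\ f x0 / 2 < f x.
    apply: filterI; first exact: open_nbhs_nbhs.
    have /cvgrPdist_lt := smooth_continuous Sf Ox0.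
    have f2 : 0 < f x0 / 2 by lra.
    move=> /(_ _ f2); apply: filterS => x; move: (f x) (f x0) => p q.
    by rewrite ltr_norml; lra.
  move=> /nbhs_ballP[r /= r0 Hr]; exists (r / 4); first lra.
  by rewrite mulrCA mulfV ?mulr1 // => x /Hr.
have : \forall y \near x0, dist2 y x0 < r ^+ 2.
  have c : {for x0, continuous (dist2 x0)} by exact: dist2_continuous.
  have dE x z : dist2 x z = dist2 z x.
    by apply: eq_bigr => i _; rewrite -opprB sqrrN.
  have d0 : dist2 x0 x0 = 0 by rewrite /dist2 big1 // => i _; rewrite subrr expr0n.
  have /cvgrPdist_lt := c => /(_ (r ^+ 2)); rewrite exprn_gt0 // => /(_ isT).
  by apply: filterS => y; rewrite d0 sub0r normrN ger0_norm ?dist2_ge0 // dE.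
apply: filterS => y yx0; apply/eqP; rewrite eq_le.
have Bx0y : ball x0 r y by apply: ball_sym; exact: dist2_ball.
(* y is within r of x0 and the annulus within 3 r of y, whence the radius 4 r above. The lower bound
   on f becomes the c of [barrier_inequality]. *)
have Oball x : dist2 y x < (3 * r) ^+ 2 -> O x /\ f x0 / 2 < f x.
  move=> yx; apply: Hr.
  have -> : 4 * r = r + 3 * r by lra.
  by apply: ball_triangle Bx0y _; apply: dist2_ball => //; lra.
have Oy : O y by apply: (Hr y _).1; apply: le_ball Bx0y; lra.
rewrite fmax //= leNgt; apply/negP => fy.
pose dl := (f x0 - f y) / 2.
have dl0 : 0 < dl by rewrite /dl; move: (f x0) (f y) fy => *; lra.
(* kp is the square of the inner radius: up to there f stays below f x0 by dl, half of its deficit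
   at y. *)
have [kp kp0 Hkp] : exists2 kp : R, 0 < kp & forall x, dist2 y x <= kp -> f x <= f x0 - dl.
  have /cvgrPdist_lt := smooth_continuous Sf Oy => /(_ _ dl0) /nbhs_ballP[e /= e0 He].
  exists (e ^+ 2 / 2); first by rewrite divr_gt0 ?exprn_gt0.
  move=> x xe; have : ball y e x.
    apply: dist2_ball => //; apply: le_lt_trans xe _.
    by rewrite ltr_pdivrMr // ltr_pMr ?exprn_gt0 //; lra.
  move=> /He /=; rewrite /dl ltr_norml; move: (f x) (f x0) (f y) => *; lra.
pose T := 4 * r ^+ 2.
have T0 : 0 < T by rewrite mulr_gt0 // exprn_gt0.
have T9 : T < (3 * r) ^+ 2.
  by rewrite exprMn /T ltr_pM2r ?exprn_gt0 //; lra.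
pose A := [set x | kp <= dist2 y x <= T].
have AO x : A x -> O x /\ f x0 / 2 < f x.
  by move=> /andP[_ xT]; apply: Oball; exact: le_lt_trans T9.
have Ax0 : A x0.
  apply/andP; split.
    rewrite leNgt; apply/negP => /ltW/Hkp; move: (f x0) => *; lra.
  by apply: (le_trans (ltW yx0)); rewrite /T ler_peMl ?sqr_ge0 //; lra.
have cA : compact A.
  apply: bounded_closed_compact.
    exists (`|y| + 3 * r); split; first exact: num_real.
    move=> M HM x [/andP[_ xT]] /=; apply/ltW; apply: le_lt_trans HM.
    have : ball y (3 * r) x by apply: dist2_ball; [lra | exact: le_lt_trans T9].
    rewrite -ball_normE /= distrC => B.
    have -> : x = y + (x - y) by rewrite addrC subrK.
    by apply: (le_trans (ler_normD _ _)); rewrite lerD2l ltW.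
  have -> : A = dist2 y @^-1` `[kp, T]%classic.
    by apply/seteqP; split => x; rewrite /A /= in_itv.
  apply: closed_comp => [x _|]; [exact: dist2_continuous | exact: itv_closed].
pose pp x := ((x - y) *m P x *m (x - y)^T) ord0 ord0.
pose KK x := \tr (P x) + (b x *m (x - y)^T) ord0 ord0.
have pp0 x : A x -> 0 < pp x.
  move=> Ax; apply: Ppos; first by have [] := AO x Ax.
  apply/eqP => /subr0_eq xy; move: Ax => /andP[+ _].
  rewrite xy /dist2 big1 => [|i _]; last by rewrite subrr expr0n.
  by rewrite leNgt kp0.
have ppc x : O x -> {for x, continuous pp}.
  move=> Ox; rewrite /pp.
  rewrite (_ : (fun _ => _) =
    (fun x => \sum_j (\sum_i (x ord0 i - y ord0 i) * P x i j) * (x ord0 j - y ord0 j))).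
    have cc i : {for x, continuous (fun x : 'rV[R]_n => x ord0 i - y ord0 i)}.
      by apply: continuousB; [exact: coord_continuous | exact: cst_continuous].
    apply: continuous_at_sum => j; apply: continuousM => //.
    by apply: continuous_at_sum => i; apply: continuousM => //; exact: Pc.
  apply/funext => z; rewrite !mxE; apply: eq_bigr => j _; rewrite !mxE; congr (_ * _).
  by apply: eq_bigr => i _; rewrite !mxE.
have KKc x : O x -> {for x, continuous KK}.
  move=> Ox; rewrite /KK; apply: continuousD.
    by apply: continuous_at_sum => i; exact: Pc.
  rewrite (_ : (fun _ => _) = (fun x => \sum_i b x ord0 i * (x ord0 i - y ord0 i))).
    apply: continuous_at_sum => i; apply: continuousM; first exact: bc.
    by apply: continuousB; [exact: coord_continuous | exact: cst_continuous].
  by apply/funext => z; rewrite !mxE; apply: eq_bigr => j _; rewrite !mxE.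
(* The annulus is compact and avoids the centre y, so pp is positive on it and the ratio is bounded;
   the bound fixes the exponent k + 2. *)
have [k Hk] : exists k : nat, forall x, A x -> T * `|KK x| / (2 * pp x) <= k%:R.
  have cF : {within A, continuous (fun x => T * `|KK x| / (2 * pp x))}.
    apply: continuous_in_subspaceT => x /set_mem Ax; have [Ox _] := AO x Ax.
    apply: (@continuousM R _ (fun x => T * `|KK x|) (fun x => (2 * pp x)^-1)).
      apply: (@continuousM R _ (cst T) (fun x => `|KK x|)); first exact: cst_continuous.
      apply: (@continuous_comp _ _ _ KK (fun t : R => `|t|)); first exact: KKc.
      exact: norm_continuous.
    apply: (@continuousV R _ (fun x => 2 * pp x)).
      by rewrite mulf_neq0 // gt_eqF // pp0.
    by apply: (@continuousM R _ (cst 2) pp); [exact: cst_continuous | exact: ppc].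
  have [c _ Hc] := EVT_max_rV (ex_intro _ _ Ax0) cA cF.
  exists (Num.bound `|T * `|KK c| / (2 * pp c)|) => x Ax.
  apply: (le_trans (Hc x (mem_set Ax))); apply/ltW/(le_lt_trans (ler_norm _)).
  by apply: archi_boundP; exact: normr_ge0.
(* The first bound controls the perturbation on the inner sphere, the second is the smallness
   required by [barrier_inequality]. *)
have [ep [ep0 ep1 ep2]] : exists e : R, [/\ 0 < e, e * T ^+ k.+2 <= dl &
    e * ((m - 1) * k.+2%:R * T ^+ k.+2) < f x0 / 2].
  apply: exists_small => //; last by lra.
    exact/ltW/exprn_gt0.
  apply: mulr_ge0; last exact/exprn_ge0/ltW.
  by rewrite mulr_ge0 // subr_ge0.
pose h := barrier y T k.+2.
have Sh : smooth O h by exact: smooth_barrier.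
pose v := fun x => f x + ep * h x.
have Sv : smooth O v.
  apply: smoothD => //; apply: (smoothM (f := cst ep)) => //; exact: smooth_cst.
have [z /set_mem Az zmax] : exists2 c, c \in A & forall t, t \in A -> v t <= v c.
  apply: EVT_max_rV => //; first by exists x0.
  apply: continuous_in_subspaceT => x /set_mem Ax; have [Ox _] := AO x Ax.
  exact: smooth_continuous Sv Ox.
have [Oz fz] := AO z Az.
(* This keeps z off both spheres: on the outer one h = 0, so v = f <= f x0; on the inner one f <= f
   x0 - dl and ep h <= dl. *)
have vz : f x0 < v z.
  apply: (@lt_le_trans _ _ (v x0)); last exact/zmax/mem_set.
  rewrite ltrDl mulr_gt0 // exprn_gt0 // subr_gt0; apply: (lt_trans yx0).
  by rewrite /T ltr_pMl ?exprn_gt0 //; lra.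
have /andP[zk zT] := Az.
have zT' : dist2 y z < T.
  rewrite lt_neqAle zT andbT; apply/eqP => zE; move: vz.
  by rewrite /v /h /barrier zE subrr expr0n mulr0 addr0 ltNge fmax.
have zk' : kp < dist2 y z.
  rewrite lt_neqAle zk andbT; apply/eqP => zE.
  have f1 : f z <= f x0 - dl by apply: Hkp; rewrite zE.
  have h1 : ep * h z <= dl.
    apply: le_trans ep1; apply: ler_wpM2l; first exact: ltW.
    rewrite /h /barrier lerXn2r // ?nnegrE ?subr_ge0 // ?(ltW T0) //.
    by rewrite gerBl dist2_ge0.
  by move: vz; rewrite /v; move: (f z) (f x0) (ep * h z) f1 h1 => *; lra.
pose O' := [set x | kp < dist2 y x < T].
have O'A : O' `<=` A by move=> x /andP[a1 a2]; apply/andP; rewrite !ltW.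
have O'O : O' `<=` O by move=> x /O'A/AO[].
have oO' : open O'.
  have -> : O' = dist2 y @^-1` `]kp, T[%classic.
    by apply/seteqP; split => x; rewrite /O' /= in_itv.
  by apply: open_comp => [x _|]; [exact: dist2_continuous | exact: itv_open].
have O'z : O' z by rewrite /O' /= zk' zT'.
have [Dv0 D2v] := smooth_max oO' (smooth_sub O'O Sv) O'z
  (fun x O'x => zmax x (mem_set (O'A x O'x))).
have d1v : partials v z = 0 by apply/rowP => i; rewrite !mxE Dv0.
have d1f : partials f z = - ep *: partials h z.
  move: d1v; rewrite (smooth_partialsDZ ep oO Sf Sh Oz) scaleNr => /eqP.
  by rewrite addr_eq0 => /eqP.
have trv : \tr (P z *m second_partials v z) <= 0.
  by apply: trace_posdef_le0; [exact: PT | exact: Ppos | exact: D2v].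
pose s := T - dist2 y z.
have d1h : partials h z = (- 2 * k.+2%:R * s ^+ k.+1) *: (z - y).
  by apply/rowP => i; rewrite !mxE derive_barrier /barrier -/s; ring.
have d2h : second_partials h z = (4 * k.+2%:R * k.+1%:R * s ^+ k) *: ((z - y)^T *m (z - y))
    - (2 * k.+2%:R * s ^+ k.+1)%:M.
  apply/matrixP => i j; rewrite !mxE second_derive_barrier /barrier -/s big_ord1 !mxE.
  by rewrite -[in RHS](mulr_natr _ (i == j)); ring.
have trh : \tr (P z *m second_partials h z) = 4 * k.+2%:R * k.+1%:R * s ^+ k * pp z
    - 2 * k.+2%:R * s ^+ k.+1 * \tr (P z).
  rewrite d2h mulmxBr -scalemxAr raddfB /= mxtraceZ mul_mx_scalar mxtraceZ.
  by rewrite mulmxA mxtrace_mulC mulmxA [\tr ((z - y) *m _ *m _)]/mxtrace big_ord1.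
apply: (@barrier_inequality k m (f z) (f x0 / 2) (pp z) (KK z) s T ep
  (\tr (P z *m second_partials v z))) => //.
- by rewrite divr_gt0 // (ltW fz).
- exact: pp0.
- by rewrite /s subr_gt0 zT' gerBl dist2_ge0.
- exact: Hk.
have Ez := E z Oz.
have tr1 : \tr (P z *m second_partials v z) = \tr (P z *m second_partials f z)
    + ep * (4 * k.+2%:R * k.+1%:R * s ^+ k * pp z
            - 2 * k.+2%:R * s ^+ k.+1 * \tr (P z)).
  by rewrite -trh (smooth_second_partialsDZ ep oO Sf Sh Oz) mulmxDr -scalemxAr mxtraceD mxtraceZ.
have b1 : (b z *m (partials f z)^T) ord0 ord0
    = 2 * ep * k.+2%:R * s ^+ k.+1 * (b z *m (z - y)^T) ord0 ord0.
  rewrite d1f d1h scalerA linearZ /= -scalemxAr mxE; congr (_ * _); ring.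
have g1 : (partials f z *m P z *m (partials f z)^T) ord0 ord0
    = (2 * ep * k.+2%:R * s ^+ k.+1) ^+ 2 * pp z.
  rewrite d1f d1h scalerA linearZ /= -!scalemxAl -scalemxAr scalerA mxE; congr (_ * _); ring.
rewrite b1 g1 in Ez.
exact: alg tr1 Ez.
Qed.

End StrongMaximum.

(** * Smooth functions on relatively open subsets of the half-space *)

Section HalfSpaceCalculus.
Variables (R : realType) (n : nat).
Implicit Types (f F : 'rV[R]_n -> R) (x y : 'rV[R]_n) (O U V : set 'rV[R]_n).

Local Notation e_ i := (basis_vec R i).
Local Notation half_space := (@half_space R n).

Lemma half_space_ray x (i : 'I_n) (h : R) : half_space x -> 0 <= h ->
  half_space (h *: e_ i + x).
Proof.
move=> Hx h0 j j0; rewrite !mxE eqxx /=; have := Hx j j0.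
by case: (_ == _); rewrite ?mulr1 ?mulr0 => ?; rewrite addr_ge0.
Qed.

Lemma half_space_within_proper x (i : 'I_n) : half_space x ->
  ProperFilter (within [set h : R | half_space (h *: e_ i + x)] 0^').
Proof.
move=> Hx; apply: Build_ProperFilter_ex => P.
rewrite /within /= /dnbhs /within /= => /nbhs_ballP[e /= e0 He].
exists (e / 2); apply: He.
- by rewrite -ball_normE /= sub0r normrN ger0_norm; lra.
- by rewrite gt_eqF //; lra.
- by apply: half_space_ray => //; lra.
Qed.

(** Small positive increments stay in the half-space, so the filter in [partial] is proper and the
    limit can be computed from any extension. Calculus up to the boundary rests on this. *)
Lemma partial_extension f F V x (i : 'I_n) : open V -> V x -> half_space x ->
  derivable F x (e_ i) -> (forall y, V y -> half_space y -> F y = f y) ->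
  partial i f x = 'D_(e_ i) F x.
Proof.
move=> oV Vx Hx dF Ff; rewrite /partial.
have PF := half_space_within_proper i Hx.
apply: cvg_lim => //.
have cF : (fun h : R => h^-1 * (F (h *: e_ i + x) - F x))
    @ within [set h | half_space (h *: e_ i + x)] 0^' --> 'D_(e_ i) F x.
  by apply: cvg_within_filter; exact: dF.
apply: cvg_trans cF; apply: near_eq_cvg.
rewrite near_withinE.
have [d d0 Hd] := open_line (e_ i) oV Vx.
have : \forall h \near (0 : R), V (h *: e_ i + x).
  by apply/nbhs_ballP; exists d => // h; rewrite -ball_normE /= sub0r normrN; exact: Hd.
move=> H; apply: nbhs_dnbhs; apply: filterS H => h Vh Hh.
by rewrite !Ff.
Qed.

Definition relopen U := exists2 V, open V & U = V `&` half_space.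

(** More than [smooth_on] provides: V meets the half-space inside U only. Then F equals f on a
    relative neighbourhood of x, and a derivative of F extends that of f. *)
Definition extends U x V F f := [/\ open V, V x, smooth V F,
  V `&` half_space `<=` U & forall y, V y -> half_space y -> F y = f y].

Lemma smooth_on_extends U f x : relopen U -> smooth_on U f -> U x ->
  exists V F, extends U x V F f.
Proof.
move=> [W oW UE] Sf Ux; have [V [F [oV Vx SF Ff]]] := Sf x Ux.
have [Wx Hx] : W x /\ half_space x by move: Ux; rewrite UE.
exists (V `&` W), F; split.
- exact: openI.
- by [].
- by apply: (@smooth_sub _ _ V) => [y []|] //; apply/smooth_openP.
- by move=> y [[_ Wy] Hy]; rewrite UE.
- by move=> y [Vy Wy] Hy; apply: Ff => //; rewrite UE.
Qed.

Lemma relopen_half U x : relopen U -> U x -> half_space x.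
Proof. by move=> [W _ ->] []. Qed.

Lemma extends_partial U x V F f y (i : 'I_n) : extends U x V F f ->
  V y -> half_space y -> partial i f y = 'D_(e_ i) F y.
Proof.
move=> [oV Vx SF VU Ff] Vy Hy; apply: (partial_extension oV Vy Hy) => //.
exact: smooth_derivable SF Vy.
Qed.

Lemma extends_D U x V F f (i : 'I_n) : extends U x V F f ->
  extends U x V ('D_(e_ i) F) (partial i f).
Proof.
move=> E; have [oV Vx SF VU Ff] := E; split => //; first exact: smooth_derive.
by move=> y Vy Hy; rewrite (extends_partial i E).
Qed.

Lemma extends_smooth_on U f : relopen U ->
  (forall x, U x -> exists V F, extends U x V F f) -> smooth_on U f.
Proof.
move=> rU H x Ux; have [V [F [oV Vx SF VU Ff]]] := H x Ux.
exists V, F; split => //; first exact/smooth_openP.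
by move=> y Vy Uy; apply: Ff => //; exact: relopen_half Uy.
Qed.

Lemma smooth_on_partial U f (i : 'I_n) : relopen U -> smooth_on U f ->
  smooth_on U (partial i f).
Proof.
move=> rU Sf; apply: extends_smooth_on => // x Ux.
have [V [F E]] := smooth_on_extends rU Sf Ux.
by exists V, ('D_(e_ i) F); exact: extends_D.
Qed.

Lemma smooth_on_ext U f g : (forall x, U x -> f x = g x) ->
  smooth_on U f -> smooth_on U g.
Proof.
move=> fg Sf x Ux; have [V [F [oV Vx SF Ff]]] := Sf x Ux.
by exists V, F; split => // y Vy Uy; rewrite Ff // fg.
Qed.

Lemma smooth_on_cst U (c : R) : smooth_on U (cst c).
Proof.
move=> x _; exists setT, (cst c); split => //; first exact: openT.
by apply/smooth_openP; apply: smooth_cst; exact: openT.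
Qed.

Lemma smooth_on_op2 U f g (op : R -> R -> R) :
  (forall O F H, open O -> smooth O F -> smooth O H -> smooth O (fun x => op (F x) (H x))) ->
  smooth_on U f -> smooth_on U g -> smooth_on U (fun x => op (f x) (g x)).
Proof.
move=> Hop Sf Sg x Ux; have [V [F [oV Vx SF Ff]]] := Sf x Ux.
have [W [H [oW Wx SH Hg]]] := Sg x Ux.
exists (V `&` W), (fun x => op (F x) (H x)); split => //.
- exact: openI.
- apply/smooth_openP; apply: Hop; first exact: openI.
    by apply: (@smooth_sub _ _ V) => [y []|] //; apply/smooth_openP.
  by apply: (@smooth_sub _ _ W) => [y []|] //; apply/smooth_openP.
- by move=> y [Vy Wy] Uy; rewrite Ff // Hg.
Qed.

Lemma smooth_onM U f g : smooth_on U f -> smooth_on U g -> smooth_on U (f \* g).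
Proof. by apply: smooth_on_op2 => O F H; exact: smoothM. Qed.

Lemma smooth_onB U f g : smooth_on U f -> smooth_on U g -> smooth_on U (f \- g).
Proof.
apply: (@smooth_on_op2 U f g (fun a b => a - b)) => O F H oO SF SH.
by apply: smoothD => //; exact: smoothN.
Qed.

Lemma smooth_onV U f : relopen U -> (forall x, U x -> f x != 0) ->
  smooth_on U f -> smooth_on U (fun x => (f x)^-1).
Proof.
move=> rU f0 Sf; apply: extends_smooth_on => // x Ux.
have [V [F E]] := smooth_on_extends rU Sf Ux.
have Hx := relopen_half rU Ux.
have [oV Vx SF VU Ff] := E.
have cF := smooth_continuous SF Vx.
have Fx0 : F x != 0 by rewrite Ff // f0.
(* The extension F may vanish beyond the boundary, even though f does not vanish on U. *)
pose W := V `&` interior [set y | F y != 0].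
have oW : open W by apply: openI => //; exact: open_interior.
have Wx : W x.
  by split=> //; apply: (cF [set t | t != 0]); apply: open_nbhs_nbhs; split; [exact: open_neq|].
exists W, (fun y => (F y)^-1); split => //.
- apply: smoothV => //; last by apply: smooth_sub SF => y [].
  by move=> y [_ /interior_subset].
- by move=> y [[Vy _] Hy]; apply: VU.
- by move=> y [Vy _] Hy; rewrite Ff.
Qed.

Lemma partialM U f g x (i : 'I_n) : relopen U -> smooth_on U f -> smooth_on U g -> U x ->
  partial i (f \* g) x = partial i f x * g x + f x * partial i g x.
Proof.
move=> rU Sf Sg Ux; have Hx := relopen_half rU Ux.
have [V [F E]] := smooth_on_extends rU Sf Ux.
have [W [H E']] := smooth_on_extends rU Sg Ux.
have [oV Vx SF VU Ff] := E; have [oW Wx SH WU Hg] := E'.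
have dF : derivable F x (e_ i) by exact: smooth_derivable SF Vx.
have dH : derivable H x (e_ i) by exact: smooth_derivable SH Wx.
rewrite (@partial_extension (f \* g) (F * H) (V `&` W) x i).
- rewrite deriveM // (extends_partial i E) // (extends_partial i E') //.
  by rewrite -(Ff x) // -(Hg x) // [LHS]addrC; congr (_ + _); exact: mulrC.
- exact: openI.
- by [].
- by [].
- exact: derivableM.
- by move=> y [Vy Wy] Hy /=; rewrite -Ff // -Hg.
Qed.

Lemma partialD U f g x (i : 'I_n) : relopen U -> smooth_on U f -> smooth_on U g -> U x ->
  partial i (f \+ g) x = partial i f x + partial i g x.
Proof.
move=> rU Sf Sg Ux; have Hx := relopen_half rU Ux.
have [V [F E]] := smooth_on_extends rU Sf Ux.
have [W [H E']] := smooth_on_extends rU Sg Ux.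
have [oV Vx SF VU Ff] := E; have [oW Wx SH WU Hg] := E'.
have dF : derivable F x (e_ i) by exact: smooth_derivable SF Vx.
have dH : derivable H x (e_ i) by exact: smooth_derivable SH Wx.
rewrite (@partial_extension (f \+ g) (F + H) (V `&` W) x i).
- by rewrite deriveD // (extends_partial i E) // (extends_partial i E').
- exact: openI.
- by [].
- by [].
- exact: derivableD.
- by move=> y [Vy Wy] Hy /=; rewrite -Ff // -Hg.
Qed.

Lemma partial_ext U f g x (i : 'I_n) : relopen U -> smooth_on U f ->
  (forall y, U y -> f y = g y) -> U x -> partial i f x = partial i g x.
Proof.
move=> rU Sf fg Ux; have Hx := relopen_half rU Ux.
have [V [F E]] := smooth_on_extends rU Sf Ux.
have [oV Vx SF VU Ff] := E.
rewrite (extends_partial i E Vx Hx); apply/esym/(partial_extension oV Vx Hx).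
  exact: smooth_derivable SF Vx.
by move=> y Vy Hy; rewrite Ff // fg //; apply: VU.
Qed.

Lemma partialC U f x (i j : 'I_n) : relopen U -> smooth_on U f -> U x ->
  partial i (partial j f) x = partial j (partial i f) x.
Proof.
move=> rU Sf Ux; have Hx := relopen_half rU Ux.
have [V [F E]] := smooth_on_extends rU Sf Ux.
have [oV Vx SF VU Ff] := E.
rewrite (extends_partial i (extends_D j E) Vx Hx).
rewrite (extends_partial j (extends_D i E) Vx Hx).
exact: smooth_schwarz oV SF Vx.
Qed.

(* Functions on the subtype of points of [U], rather than on the whole space, so
   that functions equal on [U] are equal elements of the ring. *)
Variable U : set 'rV[R]_n.
Hypothesis rU : relopen U.

Definition domain_point := {x : 'rV[R]_n | U x}.

(** The value 0 off U is a default that derivatives at points of U do not see, by [partial_ext]. *)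
Definition extend0 (phi : domain_point -> R) x : R :=
  if pselect (U x) is left Ux then phi (exist _ x Ux) else 0.

Lemma extend0E phi (t : domain_point) : extend0 phi (sval t) = phi t.
Proof.
case: t => x Ux; rewrite /extend0 /=; case: pselect => // Ux'.
by rewrite (Prop_irrelevance Ux Ux').
Qed.

Definition smooth_fun : {pred domain_point -> R} := fun phi => `[< smooth_on U (extend0 phi) >].

Lemma smooth_funP phi : reflect (smooth_on U (extend0 phi)) (phi \in smooth_fun).
Proof. exact: asboolP. Qed.

Lemma smooth_fun_subring : subring_closed smooth_fun.
Proof.
split.
- apply/smooth_funP; apply: (smooth_on_ext _ (@smooth_on_cst U 1)) => x Ux.
  by rewrite (extend0E _ (exist _ x Ux)).
- move=> f g /smooth_funP Sf /smooth_funP Sg; apply/smooth_funP.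
  apply: (smooth_on_ext _ (smooth_onB Sf Sg)) => x Ux.
  by rewrite /= !(extend0E _ (exist _ x Ux)).
- move=> f g /smooth_funP Sf /smooth_funP Sg; apply/smooth_funP.
  apply: (smooth_on_ext _ (smooth_onM Sf Sg)) => x Ux.
  by rewrite /= !(extend0E _ (exist _ x Ux)).
Qed.

HB.instance Definition _ :=
  GRing.isSubringClosed.Build (domain_point -> R) smooth_fun smooth_fun_subring.

(** The instance is that of a possibly zero ring, since U may be empty. *)
Record smooth_ring := SmoothFun { smooth_val :> domain_point -> R; _ : smooth_val \in smooth_fun }.

HB.instance Definition _ := [isSub for smooth_val].
HB.instance Definition _ := [Choice of smooth_ring by <:].
HB.instance Definition _ := GRing.SubChoice_isSubComPzRing.Build
  (domain_point -> R) smooth_fun smooth_ring smooth_fun_subring.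

Lemma smooth_ring_eqP (a b : smooth_ring) : (forall t, a t = b t) -> a = b.
Proof. by move=> ab; apply/val_inj/funext => t; exact: ab. Qed.

Lemma smooth_ringP (a : smooth_ring) : smooth_on U (extend0 a).
Proof. exact/smooth_funP/valP. Qed.

Lemma restrict_subproof f : smooth_on U f ->
  (fun t : domain_point => f (sval t)) \in smooth_fun.
Proof.
move=> Sf; apply/smooth_funP; apply: (smooth_on_ext _ Sf) => x Ux.
by rewrite (extend0E _ (exist _ x Ux)).
Qed.

Definition smooth_restrict f (Sf : smooth_on U f) : smooth_ring :=
  SmoothFun (restrict_subproof Sf).

(** Being a ring morphism, it carries matrix identities over [smooth_ring] to identities at the
    point t. *)
Definition smooth_eval (t : domain_point) (a : smooth_ring) : R := a t.

Lemma smooth_eval_zmod t : zmod_morphism (smooth_eval t).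
Proof. by []. Qed.

Lemma smooth_eval_monoid t : monoid_morphism (smooth_eval t).
Proof. by []. Qed.

HB.instance Definition _ t := GRing.isZmodMorphism.Build smooth_ring R
  (smooth_eval t) (smooth_eval_zmod t).
HB.instance Definition _ t := GRing.isMonoidMorphism.Build smooth_ring R
  (smooth_eval t) (smooth_eval_monoid t).

Definition smooth_der (i : 'I_n) (a : smooth_ring) : smooth_ring :=
  smooth_restrict (smooth_on_partial i rU (smooth_ringP a)).

(** Here f is arbitrary off U, as are the functions that [christoffel] and [hessian] differentiate:
    nothing is known of the metric there. *)
Lemma partial_der f (a : smooth_ring) (i : 'I_n) : (forall t, f (sval t) = a t) ->
  forall t, partial i f (sval t) = smooth_der i a t.
Proof.
move=> fa t; rewrite /= [RHS](partial_ext (g := f) i rU (smooth_ringP a)) //; last exact: (svalP t).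
by move=> y Uy; rewrite (extend0E _ (exist _ y Uy)) -fa.
Qed.

Lemma der_additive i (a b : smooth_ring) : smooth_der i (a + b) = smooth_der i a + smooth_der i b.
Proof.
apply: smooth_ring_eqP => t.
rewrite -(partial_der (f := extend0 a \+ extend0 b)) /=; last by move=> s; rewrite /= !extend0E.
exact: (partialD i rU (smooth_ringP a) (smooth_ringP b) (svalP t)).
Qed.

Lemma der_leibniz i (a b : smooth_ring) : smooth_der i (a * b) = smooth_der i a * b + a * smooth_der i b.
Proof.
apply: smooth_ring_eqP => t.
rewrite -(partial_der (f := extend0 a \* extend0 b)) /=; last by move=> s; rewrite /= !extend0E.
rewrite (partialM i rU (smooth_ringP a) (smooth_ringP b) (svalP t)).
by rewrite !extend0E.
Qed.

Lemma der_commute i j (a : smooth_ring) : smooth_der i (smooth_der j a) = smooth_der j (smooth_der i a).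
Proof.
apply: smooth_ring_eqP => t.
rewrite -(partial_der (f := partial j (extend0 a))); last by move=> s; exact: partial_der (extend0E _) s.
rewrite -(partial_der (f := partial i (extend0 a))); last by move=> s; exact: partial_der (extend0E _) s.
exact: (partialC i j rU (smooth_ringP a) (svalP t)).
Qed.

Definition smooth_const (c : R) : smooth_ring := smooth_restrict (@smooth_on_cst U c).

Lemma der_const i c : smooth_der i (smooth_const c) = 0.
Proof.
apply: smooth_ring_eqP => t.
rewrite -(partial_der (f := cst c)) //=.
rewrite (partial_extension (F := cst c) openT) //.
- exact: derive_cst.
- exact: relopen_half (svalP t).
Qed.

Lemma smooth_ring_inv (a : smooth_ring) : (forall t, a t != 0) -> exists b, b * a = 1.
Proof.
move=> a0.
have Sb : smooth_on U (fun x => (extend0 a x)^-1).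
  apply: smooth_onV => //; last exact: smooth_ringP.
  by move=> x Ux; rewrite (extend0E _ (exist _ x Ux)).
exists (smooth_restrict Sb); apply: smooth_ring_eqP => t.
by rewrite [LHS](_ : _ = (extend0 a (sval t))^-1 * a t) // extend0E mulVf.
Qed.

End HalfSpaceCalculus.

(** * Geometry in one chart *)

Lemma posdef_unitmx (R : realFieldType) n (G : 'M[R]_n) :
  (forall v : 'rV_n, v != 0 -> 0 < (v *m G *m v^T) ord0 ord0) -> G \in unitmx.
Proof.
move=> Gpos; rewrite -row_free_unit -kermx_eq0; apply/eqP/eqP.
rewrite -nz_row_eq0; apply/negPn/negP => v0.
have := Gpos _ v0; have /sub_kermxP -> := nz_row_sub (kermx G).
by rewrite mul0mx mxE ltxx.
Qed.

Lemma invmx_posdef (R : realFieldType) n (G : 'M[R]_n) : G^T = G ->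
  (forall v : 'rV_n, v != 0 -> 0 < (v *m G *m v^T) ord0 ord0) ->
  forall v : 'rV_n, v != 0 -> 0 < (v *m invmx G *m v^T) ord0 ord0.
Proof.
move=> GT Gpos v v0; have Gu := posdef_unitmx Gpos.
have IT : (invmx G)^T = invmx G by rewrite trmx_inv GT.
have -> : v *m invmx G *m v^T = (v *m invmx G) *m G *m (v *m invmx G)^T.
  by rewrite trmx_mul IT -(mulmxA v (invmx G) G) mulVmx // mulmx1 mulmxA.
apply: Gpos; apply/eqP => /(congr1 (mulmx^~ G)); rewrite -mulmxA mulVmx // mulmx1 mul0mx.
exact/eqP.
Qed.

Section RelativeGeometry.
Variables (R : realType) (n : nat) (U : set 'rV[R]_n) (G : 'rV[R]_n -> 'M[R]_n).
Hypotheses (rU : relopen U) (SG : forall i j, smooth_on U (fun x => G x i j)).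
Hypotheses (GT : forall x, U x -> (G x)^T = G x)
  (Gpos : forall x, U x -> forall v : 'rV_n, v != 0 -> 0 < (v *m G x *m v^T) ord0 ord0).
Implicit Types (f a b w : 'rV[R]_n -> R) (x : 'rV[R]_n).

Local Notation A := (smooth_ring U).
Local Notation D := (smooth_der rU).
Local Notation ev := smooth_eval.

Definition metric_mx : 'M[A]_n := \matrix_(i, j) smooth_restrict (SG i j).

Lemma metric_mx_eval t : map_mx (ev t) metric_mx = G (sval t).
Proof. by apply/matrixP => i j; rewrite !mxE. Qed.

Lemma metric_unit x : U x -> G x \in unitmx.
Proof. by move=> Ux; apply: posdef_unitmx; exact: Gpos. Qed.

(** Cramer's rule: the determinant is a smooth function without zeros, hence invertible in the ring,
    so the inverse metric has smooth entries. *)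
Lemma invmetric_exists : exists P : 'M[A]_n, P *m metric_mx = 1%:M.
Proof.
have [t|d dE] := smooth_ring_inv rU (a := \det metric_mx).
  have := metric_unit (svalP t); rewrite unitmxE unitfE -metric_mx_eval.
  by rewrite (det_map_mx (smooth_eval t)).
by exists (d *: \adj metric_mx); rewrite -scalemxAl mul_adj_mx scale_scalar_mx dE.
Qed.

Definition invmetric_mx : 'M[A]_n := sval (cid invmetric_exists).

Lemma mul_invmetric : invmetric_mx *m metric_mx = 1%:M.
Proof. exact: svalP (cid invmetric_exists). Qed.

Lemma mul_metric : metric_mx *m invmetric_mx = 1%:M.
Proof. exact: mulmx1C mul_invmetric. Qed.

Lemma metric_mxT : metric_mx^T = metric_mx.
Proof.
apply/matrixP => i j; rewrite !mxE; apply: smooth_ring_eqP => t /=.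
by rewrite -[in RHS](GT (svalP t)) mxE.
Qed.

Lemma invmetric_eval t : map_mx (ev t) invmetric_mx = invmx (G (sval t)).
Proof.
have Gu := metric_unit (svalP t).
have : map_mx (ev t) invmetric_mx *m G (sval t) = 1%:M.
  by rewrite -metric_mx_eval -map_mxM mul_invmetric map_mx1.
by move=> /(congr1 (mulmx^~ (invmx (G (sval t))))); rewrite mulmxK // mul1mx.
Qed.

Local Notation half := (smooth_const U 2^-1).

Let halfD : half + half = 1.
Proof.
have h : 2^-1 + 2^-1 = 1 :> R by lra.
by apply: smooth_ring_eqP => t; exact: h.
Qed.

Let dA := @der_additive R n U rU.
Let dM := @der_leibniz R n U rU.
Let dC := @der_commute R n U rU.

Lemma christoffel_eval t k i j :
  christoffel G k i j (sval t) = ev t (chr D half metric_mx invmetric_mx k i j).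
Proof.
rewrite /chr rmorphM rmorph_sum; congr (_ * _); apply: eq_bigr => l _.
rewrite rmorphM; congr (_ * _); first by rewrite -invmetric_eval mxE.
rewrite rmorphB rmorphD; congr (_ + _ - _);
  by apply: partial_der => s; rewrite mxE.
Qed.

Lemma partial_eval f (Sf : smooth_on U f) t i :
  partial i f (sval t) = ev t (D i (smooth_restrict Sf)).
Proof. exact: partial_der. Qed.

Lemma hessian_eval f (Sf : smooth_on U f) t : hessian G f (sval t)
  = map_mx (ev t) (hess D half metric_mx invmetric_mx (smooth_restrict Sf)).
Proof.
apply/matrixP => i j; rewrite !mxE rmorphB rmorph_sum; congr (_ - _).
  by apply: partial_der => s; exact: partial_der.
apply: eq_bigr => k _; rewrite rmorphM; congr (_ * _).
  exact: christoffel_eval.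
exact: partial_eval.
Qed.

Lemma riemann_eval t l k i j :
  riemann G l k i j (sval t) = ev t (riem D half metric_mx invmetric_mx l k i j).
Proof.
rewrite /riemann /riem rmorphD rmorphB rmorph_sum; congr (_ - _ + _).
- by apply: partial_der => s; exact: christoffel_eval.
- by apply: partial_der => s; exact: christoffel_eval.
- apply: eq_bigr => p _; rewrite (christoffel_eval t l i p) (christoffel_eval t p j k).
  rewrite (christoffel_eval t l j p) (christoffel_eval t p i k) [RHS]rmorphB.
  by congr (_ - _).
Qed.

Lemma ricci_eval t :
  ricci G (sval t) = map_mx (ev t) (ricmx D half metric_mx invmetric_mx).
Proof.
apply/matrixP => j k; rewrite !mxE rmorph_sum; apply: eq_bigr => i _.
exact: riemann_eval.
Qed.

Definition gradient f x : 'rV[R]_n := \row_k partial k f x.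

Definition grad_inner f a x : R :=
  (gradient f x *m invmx (G x) *m (gradient a x)^T) ord0 ord0.

Lemma gradient_eval f (Sf : smooth_on U f) t :
  gradient f (sval t) = map_mx (ev t) (drow D (smooth_restrict Sf)).
Proof. by apply/rowP => k; rewrite !mxE; exact: partial_eval. Qed.

Lemma grad_inner_eval f a (Sf : smooth_on U f) (Sa : smooth_on U a) t :
  grad_inner f a (sval t) = inner D invmetric_mx (smooth_restrict Sf) (smooth_restrict Sa) t.
Proof.
rewrite /grad_inner (gradient_eval Sf) (gradient_eval Sa) -invmetric_eval.
by rewrite map_trmx -!map_mxM mxE.
Qed.

Lemma laplacian_eval f (Sf : smooth_on U f) t : laplacian G f (sval t)
  = lap D half metric_mx invmetric_mx (smooth_restrict Sf) t.
Proof.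
by rewrite /laplacian (hessian_eval Sf) -invmetric_eval -map_mxM trace_map_mx.
Qed.

Lemma smooth_on_eval f (c : A) : (forall t, f (sval t) = c t) -> smooth_on U f.
Proof.
move=> fc; apply: (smooth_on_ext _ (smooth_ringP c)) => x Ux.
by rewrite (extend0E _ (exist _ x Ux)) -fc.
Qed.

Lemma smooth_grad_inner f a : smooth_on U f -> smooth_on U a -> smooth_on U (grad_inner f a).
Proof. by move=> Sf Sa; apply: smooth_on_eval => t; exact: grad_inner_eval. Qed.

Lemma restrict_eq f (Sf : smooth_on U f) (c : A) : (forall t, f (sval t) = c t) -> smooth_restrict Sf = c.
Proof. by move=> fc; apply: smooth_ring_eqP => t; rewrite -fc. Qed.

Lemma hessian_koszul f a b x : smooth_on U f -> smooth_on U a -> smooth_on U b -> U x ->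
  let T := (gradient a x *m invmx (G x) *m hessian G f x *m invmx (G x)
            *m (gradient b x)^T) ord0 ord0 in
  T + T = grad_inner a (grad_inner f b) x + grad_inner b (grad_inner f a) x
          - grad_inner f (grad_inner a b) x.
Proof.
move=> Sf Sa Sb Ux T; pose t : domain_point U := exist _ x Ux.
have TE : T = ev t ((drow D (smooth_restrict Sa) *m invmetric_mx
   *m hess D half metric_mx invmetric_mx (smooth_restrict Sf) *m invmetric_mx
   *m (drow D (smooth_restrict Sb))^T) ord0 ord0).
  rewrite /T (gradient_eval Sa t) (gradient_eval Sb t) (hessian_eval Sf t).
  by rewrite -(invmetric_eval t) map_trmx -!map_mxM mxE.
rewrite TE -rmorphD.
rewrite (hess_koszul dA dM dC halfD metric_mxT mul_invmetric mul_metric).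
have Sfb := smooth_grad_inner Sf Sb; have Sfa := smooth_grad_inner Sf Sa.
have Sab := smooth_grad_inner Sa Sb.
rewrite (grad_inner_eval Sa Sfb t) (grad_inner_eval Sb Sfa t) (grad_inner_eval Sf Sab t).
(* The inner products are differentiated once more, so they have to be identified as elements of the
   ring and not only pointwise. *)
rewrite (restrict_eq Sfb (grad_inner_eval Sf Sb)).
rewrite (restrict_eq Sfa (grad_inner_eval Sf Sa)).
by rewrite (restrict_eq Sab (grad_inner_eval Sa Sb)).
Qed.

Definition first_integral (m lam : R) w x : R :=
  w x * laplacian G w x + (m - 1) * grad_inner w w x + lam * (w x * w x).

Lemma first_integral_eval m lam w (Sw : smooth_on U w) t :
  first_integral m lam w (sval t) =
  (let wA := smooth_restrict Sw in
   wA * lap D half metric_mx invmetric_mx wA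
   + (smooth_const U m - 1) * inner D invmetric_mx wA wA + smooth_const U lam * (wA * wA)) t.
Proof.
by rewrite /first_integral (laplacian_eval Sw) (grad_inner_eval Sw Sw).
Qed.

Lemma smooth_first_integral m lam w : smooth_on U w ->
  smooth_on U (first_integral m lam w).
Proof. by move=> Sw; apply: smooth_on_eval => t; exact: first_integral_eval. Qed.

Lemma partial_first_integral m lam w i x : m != 0 -> smooth_on U w ->
  (forall y, U y -> hessian G w y = (w y / m) *: (ricci G y - lam *: G y)) ->
  U x -> partial i (first_integral m lam w) x = 0.
Proof.
move=> m0 Sw einstein Ux; pose t : domain_point U := exist _ x Ux.
rewrite (partial_der rU i (first_integral_eval m lam Sw) t).
rewrite (einstein_first_integral dA dM dC halfD metric_mxT mul_invmetric mul_metric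
  (minv := smooth_const U m^-1)) //.
- by apply: smooth_ring_eqP => s; rewrite [LHS](_ : _ = m * m^-1) // mulfV.
- by move=> j; exact: der_const.
- by move=> j; exact: der_const.
- by move=> j; exact: der_const.
apply/matrixP => j k; apply: smooth_ring_eqP => s.
have /matrixP/(_ j k) := einstein _ (svalP s).
by rewrite (hessian_eval Sw) (ricci_eval s) -[G _]metric_mx_eval !mxE.
Qed.

End RelativeGeometry.

(** * Change of chart *)

Section ChainRule.
Variables (R : realType) (n : nat).
Implicit Types (f q : 'rV[R]_n -> R) (x y : 'rV[R]_n) (U : set 'rV[R]_n).

Local Notation e_ i := (basis_vec R i).

Lemma half_space_box x y z : half_space x -> half_space y -> box x y z -> half_space z.
Proof.
move=> Hx Hy Bz j j0; have := Hx j j0; have := Hy j j0; have := Bz j.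
by rewrite /between; lra.
Qed.

(** The mean value points lie in the box between x and y, hence in the half-space, where the
    derivatives of the extension are those of q. *)
Lemma locally_constant U q x : relopen U -> smooth_on U q ->
  (forall y i, U y -> partial i q y = 0) -> U x ->
  exists V, [/\ open V, V x & forall y, V y -> U y -> q y = q x].
Proof.
move=> rU Sq q0 Ux; have Hx := relopen_half rU Ux.
have [V [F E]] := smooth_on_extends rU Sq Ux.
have [oV Vx SF VU Fq] := E.
have /nbhs_ballP[r /= r0 rV] : nbhs x V by exact: open_nbhs_nbhs.
exists (ball x r)^°; split; first exact: open_interior.
  exact: nbhsx_ballx.
move=> y /interior_subset By Uy; have Hy := relopen_half rU Uy.
have BV z : box x y z -> V z by move=> /(box_ball By)/rV.
have [|xi Bxi FE] := @mean_value_box R n F x y.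
  by move=> z /BV Vz i; exact: smooth_derivable SF Vz.
apply/eqP; rewrite -subr_eq0 -(Fq _ (rV _ By) Hy) -(Fq _ Vx Hx) FE big1 // => i _.
have Vxi := BV _ (Bxi i); have Hxi := half_space_box Hx Hy (Bxi i).
by rewrite -(extends_partial i E Vxi Hxi) q0 ?mulr0 //; exact: VU.
Qed.

Lemma line_at0 f x v : derivable f x v ->
  derivable (fun h : R => f (h *: v + x)) (0 : R) 1 /\
  'D_1 (fun h : R => f (h *: v + x)) (0 : R) = 'D_v f x.
Proof.
move=> df; have [|d1 dE] := @is_derive_line R n f x v 0.
  by rewrite scale0r add0r.
by split => //; rewrite dE scale0r add0r.
Qed.

(** The chain rule up to the boundary. An extension T of tau may leave the half-space, so it is
    composed with an extension F of phi to an open set. *)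
Lemma partial_comp U U' (tau : 'rV[R]_n -> 'rV[R]_n) phi x i :
  relopen U -> relopen U' -> (forall y, U y -> U' (tau y)) ->
  (forall k, smooth_on U (fun y => tau y ord0 k)) -> smooth_on U' phi -> U x ->
  partial i (phi \o tau) x
  = \sum_k partial i (fun y => tau y ord0 k) x * partial k phi (tau x).
Proof.
move=> rU rU' UU' St Sphi Ux; have Hx := relopen_half rU Ux.
have [V' [F E']] := smooth_on_extends rU' Sphi (UU' x Ux).
have [oV' V'x SF V'U Fphi] := E'.
have /choice[VT VTP] : forall k : 'I_n, exists VT : set 'rV[R]_n * ('rV[R]_n -> R),
    extends U x VT.1 VT.2 (fun y => tau y ord0 k).
  by move=> k; have [V [T ET]] := smooth_on_extends rU (St k) Ux; exists (V, T).
pose T y : 'rV[R]_n := \row_k (VT k).2 y.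
have Hnear : \forall y \near x, forall k, (VT k).1 y.
  apply: (@filter_forall _ _ (fun k y => (VT k).1 y) _ (nbhs_filter x)) => k.
  by have [oV Vx _ _ _] := VTP k; exact: open_nbhs_nbhs.
have TE y : (forall k, (VT k).1 y) -> half_space y -> T y = tau y.
  move=> Vy Hy; apply/rowP => k; rewrite mxE.
  by have [_ _ _ _ ->] := VTP k.
have Vx k : (VT k).1 x by have [] := VTP k.
have Tx : T x = tau x by exact: TE.
have cT : {for x, continuous T}.
  move=> /= P [/= B nB BP]; rewrite /nbhs /=.
  have : \forall y \near x, forall k, B ord0 k ((VT k).2 y).
    apply: (@filter_forall _ _ (fun k y => B ord0 k ((VT k).2 y)) _ (nbhs_filter x)) => k.
    have [_ Vkx Sk _ _] := VTP k; have ck := smooth_continuous Sk Vkx.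
    by apply: ck; have := nB ord0 k; rewrite mxE.
  by apply: filterS => y By; apply: BP => a k; rewrite (ord1 a) mxE.
have near2 : \forall y \near x, (forall k, (VT k).1 y) /\ V' (T y).
  apply: filterI => //; apply: (cT V'); rewrite Tx; exact: open_nbhs_nbhs.
have dk k : derivable (VT k).2 x (e_ i).
  by have [_ Vkx Sk _ _] := VTP k; exact: smooth_derivable Sk Vkx.
have Dcurve : is_derive (0 : R) (1 : R) (F \o (fun h : R => T (h *: e_ i + x)) : R -> R)
    (\sum_k 'D_(e_ i) (VT k).2 x * 'D_(e_ k) F (tau x)).
  have g0 : T ((0 : R) *: e_ i + x) = tau x by rewrite scale0r add0r.
  have comp k : (fun h : R => T (h *: e_ i + x) ord0 k) = (fun h : R => (VT k).2 (h *: e_ i + x)).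
    by apply/funext => h; rewrite mxE.
  have [||k|dc dcE] := @derive_curve R n F (fun h : R => T (h *: e_ i + x)).
  - by move=> k; rewrite g0; apply: smooth_near_derivable SF V'x.
  - by move=> k; rewrite g0; exact: smooth_continuous (smooth_derive _ SF) V'x.
  - by rewrite comp; exact: (line_at0 (dk k)).1.
  apply: DeriveDef => //; rewrite dcE; apply: eq_bigr => k _.
  by rewrite comp (line_at0 (dk k)).2 g0.
have dFT : derivable (F \o T) x (e_ i) by apply/derivable1P; have [] := Dcurve.
rewrite (@partial_extension R n _ (F \o T) [set y | (forall k, (VT k).1 y) /\ V' (T y)]^°) //.
- rewrite -(line_at0 dFT).2; have [_ ->] := Dcurve.
  apply: eq_bigr => k _; rewrite (extends_partial i (VTP k) (Vx k) Hx).
  rewrite (extends_partial k E' V'x) //.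
  exact: relopen_half rU' (UU' x Ux).
- exact: open_interior.
- move=> y /interior_subset[Vy V'Ty] Hy /=; rewrite TE //; apply: Fphi.
    by rewrite -TE.
  apply: relopen_half rU' _; apply: UU'.
  by have [_ _ _ VU _] := VTP i; apply: VU; split.
Qed.

Lemma gradient_coord y k : half_space y ->
  gradient (fun z : 'rV[R]_n => z ord0 k) y = delta_mx ord0 k.
Proof.
move=> Hy; apply/rowP => j; rewrite !mxE eqxx /=.
have [d dE] := is_derive_coord y (e_ j) k.
rewrite (partial_extension (F := fun z => z ord0 k) openT) // dE.
by rewrite !mxE eqxx eq_sym.
Qed.

Section ChangeOfChart.
Variables (U U' : set 'rV[R]_n) (G G' : 'rV[R]_n -> 'M[R]_n) (tau : 'rV[R]_n -> 'rV[R]_n).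
Hypotheses (rU : relopen U) (rU' : relopen U').
Hypotheses (SG : forall i j, smooth_on U (fun x => G x i j))
  (SG' : forall i j, smooth_on U' (fun x => G' x i j)).
Hypotheses (GT : forall x, U x -> (G x)^T = G x)
  (Gpos : forall x, U x -> forall v : 'rV_n, v != 0 -> 0 < (v *m G x *m v^T) ord0 ord0).
Hypotheses (GT' : forall x, U' x -> (G' x)^T = G' x)
  (Gpos' : forall x, U' x -> forall v : 'rV_n, v != 0 -> 0 < (v *m G' x *m v^T) ord0 ord0).
Hypotheses (tauU : forall x, U x -> U' (tau x))
  (Stau : forall k, smooth_on U (fun x => tau x ord0 k)).

Let J x : 'M[R]_n := \matrix_(k, i) partial i (fun y => tau y ord0 k) x.

Hypothesis GJ : forall x, U x -> G x = (J x)^T *m G' (tau x) *m J x.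

Definition related f f' := [/\ smooth_on U f, smooth_on U' f' & forall x, U x -> f x = f' (tau x)].

Lemma gradient_comp f f' x : related f f' -> U x ->
  gradient f x = gradient f' (tau x) *m J x.
Proof.
move=> [Sf Sf' ff'] Ux; apply/rowP => i; rewrite !mxE.
rewrite (partial_ext (g := f' \o tau) i rU Sf ff' Ux).
rewrite (partial_comp i rU rU' tauU Stau Sf' Ux).
by apply: eq_bigr => k _; rewrite !mxE mulrC.
Qed.

(** Read off from the transformation law: J is a factor of the invertible matrix G. *)
Lemma jacobian_unit x : U x -> J x \in unitmx.
Proof.
move=> Ux; have := posdef_unitmx (Gpos Ux).
by rewrite (GJ Ux) unitmx_mul => /andP[].
Qed.

Lemma invmetric_comp x : U x -> J x *m invmx (G x) *m (J x)^T = invmx (G' (tau x)).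
Proof.
move=> Ux; have Ju := jacobian_unit Ux; have Gu := posdef_unitmx (Gpos Ux).
have Gu' := posdef_unitmx (Gpos' (tauU Ux)).
have JTu : (J x)^T \in unitmx by rewrite unitmx_tr.
have E : J x *m invmx (G x) *m (J x)^T *m G' (tau x) = 1%:M.
  apply: (can_inj (mulmxK Ju)); rewrite mul1mx -!mulmxA.
  by rewrite (mulmxA (J x)^T) -(GJ Ux) mulVmx // mulmx1.
by rewrite -[LHS](mulmxK Gu') E mul1mx.
Qed.

Lemma grad_inner_comp f f' a a' x : related f f' -> related a a' -> U x ->
  grad_inner G f a x = grad_inner G' f' a' (tau x).
Proof.
move=> Rf Ra Ux; rewrite /grad_inner (gradient_comp Rf Ux) (gradient_comp Ra Ux).
by rewrite -(invmetric_comp Ux) trmx_mul !mulmxA.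
Qed.

Lemma related_grad_inner f f' a a' : related f f' -> related a a' ->
  related (grad_inner G f a) (grad_inner G' f' a').
Proof.
move=> Rf Ra; have [Sf Sf' _] := Rf; have [Sa Sa' _] := Ra.
split; [exact: smooth_grad_inner | exact: smooth_grad_inner |].
by move=> x; exact: grad_inner_comp.
Qed.

Lemma related_coord k : related (fun x => tau x ord0 k) (fun x => x ord0 k).
Proof.
split => //; move=> x U'x; exists setT, (fun x => x ord0 k); split => //; first exact: openT.
by apply/smooth_openP; apply: smooth_coord; exact: openT.
Qed.

(** A direct comparison would bring in second derivatives of tau. Instead [hessian_koszul], applied
    to the coordinate functions of the second chart and their pullbacks, compares the two Hessians
    with both indices raised. *)
Lemma laplacian_comp f f' x : related f f' -> U x ->
  laplacian G f x = laplacian G' f' (tau x).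
Proof.
have dbl (a b : R) : a + a = b + b -> a = b by lra.
move=> Rf Ux; have [Sf Sf' _] := Rf.
pose P := invmx (G x); pose P' := invmx (G' (tau x)).
pose h := hessian G f x; pose h' := hessian G' f' (tau x).
have U'x := tauU Ux; have Hx' := relopen_half rU' U'x;
have Gu := posdef_unitmx (Gpos Ux); have Gu' := posdef_unitmx (Gpos' U'x).
have gX k : gradient (fun x => tau x ord0 k) x = row k (J x).
  by apply/rowP => i; rewrite !mxE.
have E : J x *m P *m h *m P *m (J x)^T = P' *m h' *m P'.
  apply/matrixP => k l.
  pose X := fun x => tau x ord0 k; pose Y := fun x => tau x ord0 l.
  have RX := related_coord k; have RY := related_coord l.
  have [SX SX' _] := RX; have [SY SY' _] := RY.
  have K := hessian_koszul rU SG GT Gpos Sf SX SY Ux.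
  have K' := hessian_koszul rU' SG' GT' Gpos' Sf' SX' SY' U'x.
  move: K K' => /=; rewrite !gX !(gradient_coord _ Hx').
  rewrite -/P -/P' -/h -/h'.
  rewrite (grad_inner_comp RX (related_grad_inner Rf RY) Ux).
  rewrite (grad_inner_comp RY (related_grad_inner Rf RX) Ux).
  rewrite (grad_inner_comp Rf (related_grad_inner RX RY) Ux) => K K'.
  have := dbl _ _ (etrans K (esym K')).
  by rewrite trmx_delta -rowE -colE -!row_mul !mxE => <-; apply: eq_bigr => j _; rewrite !mxE.
have JGJ := GJ Ux.
have E' : P' *m h' = J x *m P *m h *m P *m (J x)^T *m G' (tau x).
  by rewrite E -(mulmxA (P' *m h')) mulVmx // mulmx1.
(* Cyclicity of the trace brings J next to J^T G', and their product is G. *)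
rewrite /laplacian -/P -/P' -/h -/h' E' -!mulmxA [RHS]mxtrace_mulC -!mulmxA.
by rewrite (mulmxA (J x)^T) -JGJ /P mulVmx // mulmx1.
Qed.

Lemma first_integral_comp m lam f f' x : related f f' -> U x ->
  first_integral G m lam f x = first_integral G' m lam f' (tau x).
Proof.
move=> Rf Ux; have [_ _ ff'] := Rf.
by rewrite /first_integral (laplacian_comp Rf Ux) (grad_inner_comp Rf Rf Ux) (ff' x Ux).
Qed.

End ChangeOfChart.

End ChainRule.

(** * Interior points *)

Section Interior.
Variables (R : realType) (n : nat).
Implicit Types (f : 'rV[R]_n -> R) (x y : 'rV[R]_n) (O U : set 'rV[R]_n).

Local Notation e_ i := (basis_vec R i).
Local Notation half_space := (@half_space R n).

Lemma Ck_local k O f : (forall x, O x -> exists V, [/\ V x & Ck k V f]) -> Ck k O f.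
Proof.
elim: k f => [|k IH] f H /=; split => //.
- by move=> x /H[V [Vx [cf _]]]; exact: cf.
- by move=> x /H[V [Vx [cf _]]]; exact: cf.
move=> i; split; first by move=> x /H[V [Vx [_ /(_ i)[df _]]]]; exact: df.
by apply: IH => x /H[V [Vx [_ /(_ i)[_ Cf]]]]; exists V.
Qed.

(** The extension given by [smooth_on] varies with the point, but near a point of the open set O it
    coincides with f, and being C^k is local. *)
Lemma smooth_on_open U O f : open O -> O `<=` U -> smooth_on U f -> smooth O f.
Proof.
move=> oO OU Sf k; apply: Ck_local => x Ox.
have [V [F [oV Vx /smooth_openP SF Ff]]] := Sf x (OU x Ox).
exists (V `&` O); split => //.
apply: (Ck_ext (openI oV oO) (f := F)); first by move=> y [Vy Oy]; apply: Ff => //; exact: OU.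
by apply: Ck_sub (SF k) => y [].
Qed.

Lemma smooth_on_sub U U2 f : U `<=` U2 -> smooth_on U2 f -> smooth_on U f.
Proof.
move=> UU Sf x /UU /Sf[V [F [oV Vx SF Ff]]]; exists V, F; split => // y Vy Uy.
by apply: Ff => //; exact: UU.
Qed.

Lemma partial_open O f x i : open O -> O `<=` half_space -> smooth O f -> O x ->
  partial i f x = 'D_(e_ i) f x.
Proof.
move=> oO OH Sf Ox; apply: (partial_extension oO Ox (OH x Ox)) => //.
exact: smooth_derivable Sf Ox.
Qed.

Lemma partial2_open O f x i j : open O -> O `<=` half_space -> smooth O f -> O x ->
  partial i (partial j f) x = 'D_(e_ i) ('D_(e_ j) f) x.
Proof.
move=> oO OH Sf Ox; apply: (partial_extension oO Ox (OH x Ox)).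
  exact: smooth_derivable (smooth_derive _ Sf) Ox.
by move=> y Oy _; rewrite (partial_open j oO OH Sf Oy).
Qed.

Lemma smooth_min O f x : open O -> smooth O f -> O x ->
  (forall y, O y -> f x <= f y) ->
  (forall i, 'D_(e_ i) f x = 0) /\
  forall v : 'rV[R]_n, 0 <= (v *m second_partials f x *m v^T) ord0 ord0.
Proof.
move=> oO Sf Ox fmin.
(* This is - f, in the form f + c g for which the derivative formulas are available. *)
pose h := fun z => f z + (- 2) * f z.
have hE z : h z = - f z by rewrite /h; ring.
have Sh : smooth O h.
  by apply: smooth_ext (smoothN oO Sf) => // z _; rewrite hE.
have hmax y : O y -> h y <= h x by move=> Oy; rewrite !hE lerN2 fmin.
have [h1 h2] := smooth_max oO Sh Ox hmax.
split=> [i|v].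
  have := h1 i; rewrite (smooth_deriveDZ (-2) i oO Sf Sf Ox).
  by move: ('D_(e_ i) f x) => a; lra.
have := h2 v; rewrite (smooth_second_partialsDZ (-2) oO Sf Sf Ox) mulmxDr mulmxDl -scalemxAr -scalemxAl.
rewrite mxE [X in _ + X]mxE; move: (fun_of_matrix _ _ _) => a; lra.
Qed.

Variables (U O : set 'rV[R]_n) (G : 'rV[R]_n -> 'M[R]_n).
Hypotheses (rU : relopen U) (SG : forall i j, smooth_on U (fun x => G x i j)).
Hypotheses (GT : forall x, U x -> (G x)^T = G x)
  (Gpos : forall x, U x -> forall v : 'rV_n, v != 0 -> 0 < (v *m G x *m v^T) ord0 ord0).
Hypotheses (oO : open O) (OU : O `<=` U).

Let OH : O `<=` half_space.
Proof. by move=> x /OU; exact: relopen_half. Qed.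

Lemma gradient_open f x : smooth O f -> O x -> gradient f x = partials f x.
Proof. by move=> Sf Ox; apply/rowP => k; rewrite !mxE (partial_open k oO OH Sf Ox). Qed.

(** The first-order coefficients of the Laplace-Beltrami operator in coordinates. *)
Definition drift x : 'rV[R]_n :=
  \row_k (- \sum_i \sum_j invmx (G x) i j * christoffel G k j i x).

Lemma laplacian_open f x : smooth O f -> O x ->
  laplacian G f x = \tr (invmx (G x) *m second_partials f x) + (drift x *m (partials f x)^T) ord0 ord0.
Proof.
move=> Sf Ox; rewrite /laplacian.
have -> : hessian G f x = second_partials f x - \matrix_(i, j) (\sum_k christoffel G k i j x * 'D_(e_ k) f x).
  apply/matrixP => i j; rewrite !mxE (partial2_open i j oO OH Sf Ox); congr (_ - _).
  by apply: eq_bigr => k _; rewrite (partial_open k oO OH Sf Ox).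
rewrite mulmxBr raddfB /=; congr (_ + _).
rewrite [RHS]mxE /mxtrace -sumrN.
under [RHS]eq_bigr do rewrite !mxE mulNr.
rewrite !sumrN; congr (- _).
under [RHS]eq_bigr do rewrite mulr_suml.
rewrite [RHS]exchange_big; apply: eq_bigr => i _ /=.
under [RHS]eq_bigr do rewrite mulr_suml.
rewrite [RHS]exchange_big mxE; apply: eq_bigr => j _ /=.
rewrite mxE mulr_sumr; apply: eq_bigr => k _; exact: mulrA.
Qed.

Lemma smooth_christoffel k i j : smooth_on U (christoffel G k i j).
Proof. by apply: smooth_on_eval => t; exact: christoffel_eval. Qed.

Lemma smooth_invmetric i j : smooth_on U (fun x => invmx (G x) i j).
Proof.
apply: (smooth_on_eval (c := invmetric_mx rU SG Gpos i j)) => t.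
by rewrite -(invmetric_eval rU SG Gpos t) mxE.
Qed.

Lemma drift_continuous x i : O x -> {for x, continuous (fun z => drift z ord0 i)}.
Proof.
move=> Ox; have sc f : smooth_on U f -> {for x, continuous f}.
  by move=> Sf; exact: smooth_continuous (smooth_on_open oO OU Sf) Ox.
rewrite (_ : (fun z => _) = (fun z => - \sum_a \sum_b invmx (G z) a b * christoffel G i b a z)).
  apply: continuousN; apply: continuous_at_sum => a; apply: continuous_at_sum => b.
  by apply: continuousM; apply: sc; [exact: smooth_invmetric | exact: smooth_christoffel].
by apply/funext => z; rewrite mxE.
Qed.

Lemma grad_inner_ge0 f x : U x -> 0 <= grad_inner G f f x.
Proof.
move=> Ux; rewrite /grad_inner; have [->|v0] := eqVneq (gradient f x) 0.
  by rewrite !mul0mx mxE.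
exact/ltW/invmx_posdef/v0/Gpos/Ux/GT.
Qed.

Lemma first_integral_max m lam f x : smooth_on U f -> O x -> 0 <= f x ->
  (forall y, O y -> f y <= f x) -> first_integral G m lam f x <= lam * (f x * f x).
Proof.
move=> SUf Ox fx0 fmax; have Sf := smooth_on_open oO OU SUf; have Ux := OU Ox.
have [D1 D2] := smooth_max oO Sf Ox fmax.
have d10 : partials f x = 0 by apply/rowP => i; rewrite !mxE D1.
rewrite /first_integral /grad_inner (gradient_open Sf Ox) d10 !mul0mx mxE mulr0 addr0.
rewrite gerDr (laplacian_open Sf Ox) d10 trmx0 mulmx0 mxE addr0.
apply: mulr_ge0_le0 => //; apply: trace_posdef_le0 => //.
- by rewrite trmx_inv GT.
- by apply: invmx_posdef; [exact: GT | exact: Gpos].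
Qed.

Lemma first_integral_min m lam f x : smooth_on U f -> O x -> 0 <= f x ->
  (forall y, O y -> f x <= f y) -> lam * (f x * f x) <= first_integral G m lam f x.
Proof.
move=> SUf Ox fx0 fmin; have Sf := smooth_on_open oO OU SUf; have Ux := OU Ox.
have [D1 D2] := smooth_min oO Sf Ox fmin.
have d10 : partials f x = 0 by apply/rowP => i; rewrite !mxE D1.
rewrite /first_integral /grad_inner (gradient_open Sf Ox) d10 !mul0mx mxE mulr0 addr0.
rewrite lerDr (laplacian_open Sf Ox) d10 trmx0 mulmx0 mxE addr0.
apply: mulr_ge0 => //; rewrite -oppr_le0 -raddfN /= -mulmxN.
apply: trace_posdef_le0.
- by rewrite trmx_inv GT.
- by apply: invmx_posdef; [exact: GT | exact: Gpos].
- by move=> v; rewrite mulmxN mulNmx mxE oppr_le0.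
Qed.

Lemma first_integral_strong_maximum m f x : 1 <= m -> smooth_on U f -> O x -> 0 < f x ->
  (forall y, O y -> f y <= f x) -> (forall y, O y -> first_integral G m 0 f y = 0) ->
  \forall y \near x, f y = f x.
Proof.
move=> m1 SUf Ox fx0 fmax Q0; have Sf := smooth_on_open oO OU SUf.
apply: (strong_maximum (m := m) (P := fun y => invmx (G y)) (b := drift) m1 oO Sf Ox fx0 fmax).
- by move=> y /OU Uy; rewrite trmx_inv GT.
- by move=> y /OU Uy; apply: invmx_posdef; [exact: GT | exact: Gpos].
- by move=> y i j Oy; exact: smooth_continuous (smooth_on_open oO OU (smooth_invmetric i j)) Oy.
- by move=> y i; exact: drift_continuous.
move=> y Oy; rewrite -(laplacian_open Sf Oy) -(gradient_open Sf Oy).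
by have := Q0 y Oy; rewrite /first_integral mul0r addr0.
Qed.

End Interior.

(** * The manifold *)

Lemma clopen_setT (M : topologicalType) (B : set M) : connected [set: M] ->
  B !=set0 -> open B -> open (~` B) -> B = setT.
Proof.
move=> cM B0 oB oB'; apply: cM => //.
- by exists B => //; rewrite setTI.
- by exists B; rewrite ?setTI // -openC.
Qed.

Lemma locally_constant_connected (M : topologicalType) (T : Type) (q : M -> T) :
  connected [set: M] -> (forall p, \forall p' \near p, q p' = q p) ->
  forall p p', q p = q p'.
Proof.
move=> cM qloc p p'.
suff H : [set r | q p = q r] = setT.
  by have : [set r | q p = q r] p' by rewrite H.
apply: clopen_setT => //; first by exists p.
- rewrite openE => r /= pr; apply: filterS (qloc r) => s sr.
  by rewrite /= sr.
- rewrite openE => r /= pr; apply: filterS (qloc r) => s sr.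
  by rewrite /= sr.
Qed.

Section EinsteinManifold.
Variables (R : realType) (n : nat) (m lambda : R) (M : topologicalType).
Variables (A : set (chart R n M)) (g : chart R n M -> 'rV[R]_n -> 'M[R]_n) (w : M -> R).
Hypothesis m1 : 1 <= m.
Hypothesis E : einstein_manifold lambda m A g w.

Let EA : smooth_atlas A := manifold_atlas (einstein_smooth_manifold E).
Let Eg : riemannian_metric A g := einstein_metric E.

Let m0 : m != 0.
Proof. by rewrite gt_eqF // (lt_le_trans ltr01). Qed.

Section Chart.
Variable c : chart R n M.
Hypothesis Ac : A c.

Let Cc : is_chart c := atlas_chart EA Ac.

Definition chart_fun : 'rV[R]_n -> R := w \o cinv c.
Definition chart_integral : 'rV[R]_n -> R := first_integral (g c) m lambda chart_fun.

Lemma relopen_cimg : relopen (cimg c).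
Proof. by have [V oV VE] := cimg_open Cc; exists V. Qed.

Lemma smooth_chart_fun : smooth_on (cimg c) chart_fun.
Proof. exact: (einstein_smooth E Ac). Qed.

Lemma cmapK_in p : cdom c p -> cinv c (cmap c p) = p.
Proof. by move=> cp; apply: (cmapK Cc); rewrite inE. Qed.

Lemma cimg_cmap p : cdom c p -> cimg c (cmap c p).
Proof. by move=> cp; exists p. Qed.

Lemma chart_funE p : cdom c p -> chart_fun (cmap c p) = w p.
Proof. by move=> cp; rewrite /chart_fun /= cmapK_in. Qed.

Lemma metric_chart_T x : cimg c x -> (g c x)^T = g c x.
Proof. by move=> Ux; apply: (Defs.metric_sym Eg Ac). Qed.

Lemma metric_chart_pos x : cimg c x ->
  forall v : 'rV_n, v != 0 -> 0 < (v *m g c x *m v^T) ord0 ord0.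
Proof. by move=> Ux; apply: (metric_posdef Eg Ac). Qed.

Lemma metric_chart_smooth i j : smooth_on (cimg c) (fun x => g c x i j).
Proof. exact: (metric_smooth Eg Ac). Qed.

Lemma near_cmap p (P : set 'rV[R]_n) : cdom c p -> nbhs (cmap c p) P ->
  \forall p' \near p, cdom c p' /\ P (cmap c p').
Proof.
move=> cp nP; have od := cdom_open Cc.
apply: filterI; first exact: open_nbhs_nbhs.
have := cmap_continuous Cc; rewrite (continuous_open_subspace _ od) => /(_ p).
by rewrite inE => /(_ cp); apply.
Qed.

Lemma chart_integral_locally_constant p : cdom c p ->
  \forall p' \near p, cdom c p' /\ chart_integral (cmap c p') = chart_integral (cmap c p).
Proof.
move=> cp; have Ux := cimg_cmap cp; have rU := relopen_cimg.
have SQ : smooth_on (cimg c) chart_integral.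
  apply: smooth_first_integral => //; [exact: metric_chart_smooth | exact: metric_chart_pos
   | exact: smooth_chart_fun].
have Q0 y i : cimg c y -> partial i chart_integral y = 0.
  apply: (partial_first_integral rU) => //; [exact: metric_chart_smooth | exact: metric_chart_T
   | exact: metric_chart_pos | exact: smooth_chart_fun | exact: (einstein_eq E Ac)].
have [V [oV Vx VQ]] := locally_constant rU SQ Q0 Ux.
apply: filterS (near_cmap cp (open_nbhs_nbhs (conj oV Vx))) => p' [cp' Vp'].
by split=> //; apply: VQ => //; exact: cimg_cmap.
Qed.

(** [boundary] asks for one chart only, so a point outside it has a positive normal coordinate in
    every chart around it. *)
Lemma interior_neighborhood p : cdom c p -> ~ boundary A p ->
  exists O, [/\ open O, O `<=` cimg c & O (cmap c p)].
Proof.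
move=> cp np; have [V oV VE] := cimg_open Cc.
have [Vx Hx] : V (cmap c p) /\ half_space (cmap c p).
  by have := cimg_cmap cp; rewrite VE.
have [i i0 xi] : exists2 i : 'I_n, i = 0%N :> nat & 0 < cmap c p ord0 i.
  apply: contrapT => H; apply: np; exists c; split => // i i0.
  apply/eqP; rewrite eq_le Hx // andbT leNgt; apply/negP => xi.
  by apply: H; exists i.
exists (V `&` [set y | 0 < y ord0 i]); split => //.
- apply: openI => //.
  apply: (@open_comp _ _ (fun y : 'rV[R]_n => y ord0 i) [set t | 0 < t]); last exact: open_gt.
  by move=> y _; exact: coord_continuous.
- move=> y [Vy yi]; rewrite VE; split => // j j0.
  have -> : j = i by apply/val_inj; rewrite /= j0 i0.
  exact: ltW.
Qed.

End Chart.

(** The calculus with [partial] takes place on relatively open sets; that the image of an overlap is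
    one comes from the continuity of [cinv c]. *)
Lemma relopen_overlap c c' : A c -> A c' ->
  relopen (cmap c @` (cdom c `&` cdom c')).
Proof.
move=> Ac Ac'; have Cc := atlas_chart EA Ac; have Cc' := atlas_chart EA Ac'.
have [V oV VE] := cimg_open Cc.
have /continuousP/(_ _ (cdom_open Cc')) := cinv_continuous Cc.
move=> /open_subspaceP[W oW WE].
exists (V `&` W); first exact: openI.
apply/seteqP; split => [x [p [cp cp'] <-]|x [[Vx Wx] Hx]].
  have Ux := cimg_cmap cp.
  have : (cinv c @^-1` cdom c' `&` cimg c) (cmap c p).
    by split => //; rewrite /preimage /= cmapK_in.
  rewrite -WE => -[Wx _]; move: Ux; rewrite VE => -[Vx Hx].
  by [].
have Ux : cimg c x by rewrite VE.
have : (W `&` cimg c) x by [].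
rewrite WE => -[c'x _]; have [p cp px] := Ux.
have : cdom c' (cinv c x) by exact: c'x.
by rewrite -px cmapK_in // => c'p; exists p.
Qed.

Lemma chart_integral_comp c c' p : A c -> A c' -> cdom c p -> cdom c' p ->
  chart_integral c (cmap c p) = chart_integral c' (cmap c' p).
Proof.
move=> Ac Ac' cp c'p.
pose U := cmap c @` (cdom c `&` cdom c').
have UU : U `<=` cimg c by move=> x [q [cq _] <-]; exists q.
pose tau x := cmap c' (cinv c x).
have tauE q : cdom c q -> tau (cmap c q) = cmap c' q by move=> cq; rewrite /tau cmapK_in.
have rU : relopen U by exact: relopen_overlap.
have rU' := relopen_cimg Ac'.
have tauU x : U x -> cimg c' (tau x).
  by move=> [q [cq c'q] <-]; rewrite tauE //; exact: cimg_cmap.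
have GJ x : U x -> g c x = (Defs.jacobian c c' x)^T *m g c' (tau x) *m Defs.jacobian c c' x.
  by move=> [q [cq c'q] <-]; rewrite tauE //; exact: (metric_tensor Eg Ac Ac' cq c'q).
have Rw : related U (cimg c') tau (chart_fun c) (chart_fun c').
  split; [exact: smooth_on_sub UU (smooth_chart_fun Ac) | exact: smooth_chart_fun |].
  by move=> x [q [cq c'q] <-]; rewrite tauE // !chart_funE.
have Ux : U (cmap c p) by exists p.
rewrite -(tauE p cp) /chart_integral.
apply: (first_integral_comp (U := U) (U' := cimg c') (tau := tau) rU rU') => //.
- by move=> i j; exact: smooth_on_sub UU (metric_chart_smooth Ac i j).
- by move=> i j; exact: metric_chart_smooth.
- by move=> x /UU; exact: metric_chart_T.
- by move=> x /UU; exact: metric_chart_pos.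
- by move=> x; exact: metric_chart_T.
- by move=> x; exact: metric_chart_pos.
- by move=> k; exact: (atlas_smooth EA Ac Ac').
Qed.

Lemma chart_integral_const : exists k : R, forall c p, A c -> cdom c p ->
  chart_integral c (cmap c p) = k.
Proof.
have [[p0]|M0] := pselect (exists p : M, True); last first.
  by exists 0 => c p; exfalso; apply: M0; exists p.
move=> _; have /choice[ch chP] : forall p, exists c, A c /\ cdom c p.
  by move=> p; have [c Ac cp] := atlas_cover EA p; exists c.
(* By [QE] the choice of charts is immaterial, so near p the chart of p computes Q at all points. *)
pose Q p := chart_integral (ch p) (cmap (ch p) p).
have QE c p : A c -> cdom c p -> chart_integral c (cmap c p) = Q p.
  by move=> Ac cp; have [Ach chp] := chP p; exact: chart_integral_comp.
have Qloc p : \forall p' \near p, Q p' = Q p.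
  have [Ac cp] := chP p.
  apply: filterS (chart_integral_locally_constant Ac cp) => p' [cp' QQ].
  by rewrite -(QE _ _ Ac cp') -(QE _ _ Ac cp).
exists (Q p0) => c p Ac cp; rewrite QE //.
exact: locally_constant_connected (einstein_connected E) Qloc p p0.
Qed.

Lemma einstein_fun_continuous : continuous w.
Proof.
move=> p; have [c Ac cp] := atlas_cover EA p.
have [V [F [oV Vx SF VU Fw]]] := smooth_on_extends (relopen_cimg Ac) (smooth_chart_fun Ac) (cimg_cmap cp).
have cF := smooth_continuous SF Vx.
have FE q : cdom c q -> V (cmap c q) -> F (cmap c q) = w q.
  move=> cq Vq; rewrite Fw ?chart_funE //.
  exact: relopen_half (relopen_cimg Ac) (cimg_cmap cq).
apply/cvgrPdist_lt => e e0.
have Hn : nbhs (cmap c p) [set y | `|F (cmap c p) - F y| < e /\ V y].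
  apply: filterI; last exact: open_nbhs_nbhs.
  by have /cvgrPdist_lt := cF; exact.
apply: filterS (near_cmap Ac cp Hn) => q [cq [Fq Vq]].
by rewrite -(FE p) // -(FE q).
Qed.

Theorem compact_einstein_const : lambda <= 0 -> compact [set: M] -> trivial_einstein w.
Proof.
move=> l0 cM.
have wb p : boundary A p -> w p = 0 by exact: (einstein_boundary E).
have wi p : ~ boundary A p -> 0 < w p by exact: (einstein_interior E).
(* If w is nowhere positive, every point is a boundary point and w = 0; an empty M falls under this
   case. *)
have [[p0 wp0]|w0] := pselect (exists p, 0 < w p); last first.
  exists 0 => p; apply: wb; apply: contrapT => /wi wp; apply: w0; by exists p.
have wpos p : 0 <= w p.
  by have [/wb ->//|/wi/ltW] := pselect (boundary A p).
have npos p : 0 < w p -> ~ boundary A p by move=> + /wb wp; rewrite wp ltxx.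
have M0 : [set: M] !=set0 by exists p0.
have cw : {within [set: M], continuous w}.
  by apply: continuous_subspaceT; exact: einstein_fun_continuous.
have [pM _ wM] := compact_EVT_max M0 cM cw.
have [pm _ wm] := compact_EVT_min M0 cM cw.
have {}wM p : w p <= w pM by apply: wM; rewrite inE.
have {}wm p : w pm <= w p by apply: wm; rewrite inE.
have [k kE] := chart_integral_const.
have wpM : 0 < w pM by exact: lt_le_trans wp0 (wM p0).
have [cM' AM cpM] := atlas_cover EA pM.
have [cm Am cpm] := atlas_cover EA pm.
have kmax : k <= lambda * (w pM * w pM).
  have [W [oW WU Wx]] := interior_neighborhood AM cpM (npos pM wpM).
  rewrite -(kE _ _ AM cpM) -{1 2}(chart_funE AM cpM).
  apply: (first_integral_max (relopen_cimg AM) (metric_chart_T AM)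
    (metric_chart_pos AM) oW WU) => //; first exact: smooth_chart_fun.
    by rewrite chart_funE.
  by move=> y Wy; rewrite chart_funE //; exact: wM.
have kmin : lambda * (w pm * w pm) <= k.
  (* If w vanishes at pm, which may be a boundary point, Q is (m - 1) |grad w|^2 there, nonnegative
     as m >= 1. Otherwise pm is interior and the second-derivative test applies. *)
  have := wpos pm; rewrite le_eqVlt => /orP[/eqP wpm|wpm].
    rewrite -wpm !mulr0 -(kE _ _ Am cpm) /chart_integral /first_integral chart_funE // -wpm.
    rewrite !mul0r add0r mulr0 addr0 mulr_ge0 ?subr_ge0 //.
    apply: (grad_inner_ge0 (metric_chart_T Am) (metric_chart_pos Am)).
    exact: cimg_cmap.
  have [W [oW WU Wx]] := interior_neighborhood Am cpm (npos pm wpm).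
  rewrite -(kE _ _ Am cpm) -{1 2}(chart_funE Am cpm).
  apply: (first_integral_min (relopen_cimg Am) (metric_chart_T Am)
    (metric_chart_pos Am) oW WU) => //; first exact: smooth_chart_fun.
    by rewrite chart_funE.
  by move=> y Wy; rewrite chart_funE //; exact: wm.
have lmM := le_trans kmin kmax.
move: l0; rewrite le_eqVlt => /orP[/eqP l0|l0]; last first.
  exists (w pM) => p; apply/eqP; rewrite eq_le wM /=; apply: le_trans (wm p).
  move: lmM; rewrite ler_nM2l // => H.
  by rewrite -(@ler_pXn2r _ 2) ?nnegrE // ?expr2 ?wpos.
have k0 : k = 0.
  by apply/eqP; rewrite eq_le; move: kmin kmax; rewrite l0 !mul0r => -> ->.
exists (w pM) => p.
suff H : [set q | w q = w pM] = setT.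
  by have : [set q | w q = w pM] p by rewrite H.
apply: clopen_setT (einstein_connected E) _ _ _; first by exists pM.
  rewrite openE => q /= wq; have wq0 : 0 < w q by rewrite wq.
  have [c Ac cq] := atlas_cover EA q.
  have [W [oW WU Wx]] := interior_neighborhood Ac cq (npos q wq0).
  have Hn : \forall y \near cmap c q, chart_fun c y = chart_fun c (cmap c q).
    apply: (first_integral_strong_maximum (relopen_cimg Ac) (metric_chart_smooth Ac)
      (metric_chart_T Ac) (metric_chart_pos Ac) oW WU m1 (smooth_chart_fun Ac) Wx).
    - by rewrite chart_funE.
    - by move=> y Wy; rewrite chart_funE // wq; exact: wM.
    - by move=> y /WU[r cr <-]; have := kE c r Ac cr; rewrite k0 /chart_integral l0.
  apply: filterS (near_cmap Ac cq Hn) => r [cr].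
  by rewrite /= !chart_funE // wq.
rewrite (_ : ~` _ = w @^-1` [set t | t != w pM]); last first.
  by apply/seteqP; split => r /=; [move=> H; exact/eqP | move=> /eqP].
apply: open_comp; last exact: open_neq.
by move=> r _; exact: einstein_fun_continuous.
Qed.

End EinsteinManifold.

Theorem theorem1p3 (R : realType) (n : nat) (m lambda : R)
    (M : topologicalType) (A : set (chart R n M))
    (g : chart R n M -> 'rV[R]_n -> 'M[R]_n) (w : M -> R) :
  (1 <= n)%N -> 1 <= m -> lambda <= 0 ->
  einstein_manifold lambda m A g w ->
  compact [set: M] ->
  trivial_einstein w.
Proof. by move=> _ m1 l0 E; exact: compact_einstein_const m1 E l0. Qed.
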